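(* Let $n\ge 1$, $q=(q_1,\dots,q_n)\in(0,\infty)^n$ and $z\in\mathcal W^n$. Let $(\mathfrak X(t);t\ge 0)$ be the continuous-time Markov process on the set $\mathbb K_n$ of integer Gelfand-Tsetlin patterns with the blocking-and-pushing dynamics with rates $q$ described in the context. If $\mathfrak X(0)$ has distribution $M_z(\cdot)$, then the bottom row $(\mathfrak X^n(t);t\ge 0)$ is distributed as an $n$-dimensional Markov process on $\mathcal W^n$, started from $z$, with conservative $Q$-matrix $$Q(x,x+e_i)=\frac{S_{x+e_i}(q)}{S_x(q)}\mathbf 1_{[x+e_i\in\mathcal W^n]},\qquad 1\le i\le n,\ x\in\mathcal W^n,$$ and all other off-diagonal entries equal to zero.
   Context: $\mathcal W^n=\{z\in\mathbb Z^n: z_1\le z_2\le\dots\le z_n\}$; $e_i$ is the $i$-th standard basis vector. A $Q$-matrix is conservative if each row sums to zero (so its diagonal is determined by its off-diagonal entries). Gelfand-Tsetlin patterns: $\mathbb K_n=\{(x^1,\dots,x^n)\in\mathbb Z^1\times\mathbb Z^2\times\dots\times\mathbb Z^n: x^{k+1}_i\le x^k_i\le x^{k+1}_{i+1},\ 1\le i\le k<n\}$, and for $z\in\mathcal W^n$, $\mathbb K_n(z)=\{x\in\mathbb K_n:x^n=z\}$. Weights: for a vector $z\in\mathbb R^d$, $|z|=\sum_{i=1}^d z_i$, and $|x^0|=0$. For $x\in\mathbb K_n$, $w^q(x)=\prod_{i=1}^n q_i^{|x^i|-|x^{i-1}|}$. The Schur function is $S_z(q)=S_z(q_1,\dots,q_n)=\sum_{x\in\mathbb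 K_n(z)}w^q(x)$, and $M_z(x)=w^q(x)/S_z(q)$ for $x\in\mathbb K_n(z)$ is a probability mass function on $\mathbb K_n(z)$. Dynamics of $\mathfrak X$: the components $\mathfrak X^k_j$, $1\le j\le k\le n$, are positions of particles on $\mathbb Z$. Each particle $\mathfrak X^k_j$ attempts, independently of the others, to jump one unit to the right at rate $q_k$ (i.e. after independent exponential waiting times of mean $q_k^{-1}$). Blocking: for $1\le j<k$, an attempted jump of $\mathfrak X^k_j$ at time $t$ is suppressed if, just before the jump, $\mathfrak X^k_j=\mathfrak X^{k-1}_j$; otherwise it succeeds. Attempted jumps of $\mathfrak X^k_k$ always succeed. Pushing: whenever a particle $\mathfrak X^{k-1}_j$ jumps (of its own accord or because it is itself pushed) and just before the jump $\mathfrak X^{k-1}_j=\mathfrak X^k_{j+1}$, the particle $\mathfrak X^k_{j+1}$ is simultaneously moved one unit to the right. The process thus remains in $\mathbb K_n$. *)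

(* Defs.v *)
From mathcomp Require Import all_boot all_order all_algebra.
From mathcomp Require Import all_classical all_reals all_analysis.
Import Order.TTheory GRing.Theory Num.Theory.
Import numFieldNormedType.Exports.
Set Implicit Arguments.
Unset Strict Implicit.
Unset Printing Implicit Defensive.
Local Open Scope classical_set_scope.
Local Open Scope ring_scope.

(** * Continuous-time Markov processes on a countable state space *)

Definition conservative (R : realType) (S : countType) (off : S -> S -> R)
    (x y : S) : R :=
  if x == y then - \sum_(u \in [set u | u != x]) off x u else off x y.

Record transition_function (R : realType) (S : countType)
    (p : R -> S -> S -> R) : Prop := TransitionFunction {
  tf_ge0 : forall t x y, 0 <= t -> 0 <= p t x y ;
  tf_sum1 : forall t x, 0 <= t ->
    (\esum_(y in [set: S]) (p t x y)%:E = 1)%E ;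
  tf_zero : forall x y, p 0 x y = (x == y)%:R ;
  tf_add : forall s t x y, 0 <= s -> 0 <= t ->
    ((p (s + t) x y)%:E = \esum_(u in [set: S]) (p s x u * p t u y)%:E)%E }.

(** The Q-matrix of a transition function is its right derivative at time 0.
    When the diagonal of a conservative [Q] is bounded, as it is for both
    matrices below, [Q] determines [p]. *)
Definition has_Qmatrix (R : realType) (S : countType)
    (p : R -> S -> S -> R) (Q : S -> S -> R) : Prop :=
  forall x y, (p t x y - (x == y)%:R) / t @[t --> 0^'+] --> Q x y.

(** Only the times [0 <= t] of [X] are meaningful. *)
Record markov_process (R : realType) (S : countType) (d : measure_display)
    (T : measurableType d) (P : probability T R)
    (mu : S -> R) (Q : S -> S -> R) (X : R -> T -> S) : Prop := MarkovProcess {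
  mp_measurable : forall t x, 0 <= t -> measurable [set w | X t w = x] ;
  mp_right_continuous : {ae P, forall w, forall t, 0 <= t ->
    \forall s \near t^'+, X s w = X t w} ;
  mp_fdd : exists p : R -> S -> S -> R,
    [/\ transition_function p, has_Qmatrix p Q &
      forall (m : nat) (t : nat -> R) (x : nat -> S),
        t 0%N = 0 -> (forall i, (i < m)%N -> t i <= t i.+1) ->
        P [set w | forall i, (i <= m)%N -> X (t i) w = x i] =
        (mu (x 0%N) * \prod_(i < m) p (t i.+1 - t i) (x i) (x i.+1))%:E] }.

(** * Gelfand-Tsetlin patterns *)

(** The pair [(a, b)] of 0-based indices stands for the particle in position
    [j = b + 1] of row [k = a + 1]; thus [j <= k]. *)
Definition particle (n : nat) : Type :=
  {ab : 'I_n * 'I_n | (ab.2 <= ab.1)%N}.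

Definition rowp n (p : particle n) : nat := (val p).1.+1.
Definition posp n (p : particle n) : nat := (val p).2.+1.

(** The elements of Z^1 x Z^2 x ... x Z^n. *)
Definition triangle (n : nat) : Type := {ffun particle n -> int}.

Definition interlacing n (x : triangle n) : bool :=
  [forall p, forall p', (rowp p' == (rowp p).+1) ==>
    (((posp p' == posp p) ==> (x p' <= x p)) &&
     ((posp p' == (posp p).+1) ==> (x p <= x p')))].

Definition pattern (n : nat) : Type := {x : triangle n | interlacing x}.

Definition weakly_increasing n (z : {ffun 'I_n -> int}) : bool :=
  [forall i : 'I_n, forall j : 'I_n, (j == i.+1 :> nat) ==> (z i <= z j)].

Definition weyl (n : nat) : Type :=
  {z : {ffun 'I_n -> int} | weakly_increasing z}.

Lemma last_row_subproof n (i : 'I_n) : (n.-1 < n)%N.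
Proof. by case: n i => [[]|]. Qed.

Lemma bottom_particle_subproof n (i : 'I_n) :
  (i <= Ordinal (last_row_subproof i))%N.
Proof. by case: n i => [[]|n i] //=; rewrite -ltnS. Qed.

Definition bottom_particle n (i : 'I_n) : particle n :=
  exist _ (Ordinal (last_row_subproof i), i) (bottom_particle_subproof i).

Lemma bottom_row_subproof n (x : pattern n) :
  weakly_increasing [ffun i => val x (bottom_particle i)].
Proof.
case: x => x /= /forallP hx.
apply/forallP => i; apply/forallP => j; apply/implyP => /eqP ij.
rewrite !ffunE.
have a1 : (n.-2 < n)%N by case: n i {hx x j ij} => [[]|[]].
have a2 : (i <= n.-2)%N.
  by move: (ltn_ord j); rewrite ij; case: n {hx x j ij a1} i => [|[|n]] i.
have a3 : n.-1 = n.-2.+1.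
  by move: (ltn_ord j); rewrite ij; case: n {hx x j ij a1 a2} i => [|[|n]] i.
pose u : particle n := exist _ (Ordinal a1, i) a2.
have /forallP hu := hx u.
have := hu (bottom_particle i); have := hu (bottom_particle j).
rewrite /rowp /posp /= a3 ij !eqxx /= => /andP[_ h1] /andP[h2 _].
exact: le_trans h2 h1.
Qed.

(** The bottom row [x^n] of a pattern. *)
Definition bottom_row n (x : pattern n) : weyl n :=
  exist (fun z => weakly_increasing z) _ (bottom_row_subproof x).

(** * Schur functions *)

(** [rowsum x k] is |x^k|; in particular it vanishes for [k = 0]. *)
Definition rowsum n (x : triangle n) (k : nat) : int :=
  \sum_(p : particle n | rowp p == k) x p.

(** Index [i : 'I_n] of [q] stands for q_(i+1). *)
Definition weight (R : realType) n (q : 'I_n -> R) (x : pattern n) : R :=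
  \prod_(i < n) q i ^ (rowsum (val x) i.+1 - rowsum (val x) i).

(** The index set is finite because of the interlacing inequalities. *)
Definition schur (R : realType) n (q : 'I_n -> R) (z : {ffun 'I_n -> int}) : R :=
  \sum_(x \in [set x : pattern n | val (bottom_row x) = z]) weight q x.

Definition schur_pmf (R : realType) n (q : 'I_n -> R) (z : weyl n)
    (x : pattern n) : R :=
  if bottom_row x == z then weight q x / schur q (val z) else 0.

(** * The blocking-and-pushing dynamics *)

(** Since no particle of the previous row has position [k] when [k] is the
    row of [p], the rightmost particle of a row is never blocked. *)
Definition blocked n (x : triangle n) (p : particle n) : bool :=
  [exists p', [&& rowp p == (rowp p').+1, posp p == posp p' & x p == x p']].

Definition pushes n (x : triangle n) : rel (particle n) := fun p p' =>
  [&& rowp p' == (rowp p).+1, posp p' == (posp p).+1 & x p == x p'].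

(** A successful jump of [p] moves [p] and everything it pushes, directly or
    through a chain of pushed particles, by one unit. *)
Definition jump n (x : triangle n) (p : particle n) : triangle n :=
  [ffun p' => x p' + (connect (pushes x) p p')%:Z].

Definition GT_rate (R : realType) n (q : 'I_n -> R) (x y : pattern n) : R :=
  \sum_(p : particle n | ~~ blocked (val x) p && (jump (val x) p == val y))
    q (val p).1.

Definition GT_Qmatrix (R : realType) n (q : 'I_n -> R) :
    pattern n -> pattern n -> R :=
  conservative (GT_rate q).

(** * The Markov process on the Weyl chamber *)

Definition basis_vector n (i : 'I_n) : {ffun 'I_n -> int} :=
  [ffun j => (j == i)%:Z].

(** At most one [i] contributes, and the indicator of [x + e_i] lying in the
    chamber is enforced by the type of [y]. *)
Definition schur_rate (R : realType) n (q : 'I_n -> R) (x y : weyl n) : R :=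
  \sum_(i < n | val y == val x + basis_vector i)
    schur q (val x + basis_vector i) / schur q (val x).

Definition schur_Qmatrix (R : realType) n (q : 'I_n -> R) :
    weyl n -> weyl n -> R :=
  conservative (schur_rate q).

(* Main.v *)
Require Import Defs.
From mathcomp Require Import all_boot all_order all_algebra ring lra zify.
From mathcomp Require Import all_classical all_reals all_analysis.
Import Order.TTheory GRing.Theory Num.Theory.
Import numFieldNormedType.Exports.
Set Implicit Arguments.
Unset Strict Implicit.
Unset Printing Implicit Defensive.
Local Open Scope classical_set_scope.
Local Open Scope ring_scope.

(** Let [M] be the kernel from [W^n] to [K_n] that gives [x] in [K_n(z)] the mass
    [M_z(x)], let [G] be the generator of the patterns and [Q] the one of the
    Schur process. The theorem follows from the intertwining [M G = Q M].

    For the latter, fix a pattern [y]. A jump into [y] moves a chain of particles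
    lying on one diagonal and is determined by the last particle [e] of the chain:
    its first particle is the highest one on the diagonal of [e] that has the
    value of [e] in [y]. If the chain starts in row [k] of [x] and ends in row [r]
    then [w(x) q_k = w(y) q_(r+1)], or [w(x) q_k = w(y)] if [r = n]. For [r < n],
    such a jump exists iff the particle in row [r + 1] below [e] is not blocked in
    [y], so the weighted inflow that keeps the bottom row fixed is [w(y)] times
    the total rate of [y] minus [q_1 + ... + q_n]. The chain ending in the bottom
    row at [i] accounts for the transition from [z] to [z + e_i].

    The matrix intertwining lifts to the transition function [p] of the patterns:
    [M p_t (z, y) / M(y)] solves the backward equation of the bounded matrix [Q],
    and its initial value depends on [y] only through the bottom row; by
    uniqueness so do its values at all times. *)

(** * Sums over fibres and uniqueness for bounded backward equations *)

Lemma eq_sum_supp (V : nmodType) (I : eqType) (r s : seq I) (F : I -> V) :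
  uniq r -> uniq s ->
  (forall i, i \in r -> i \notin s -> F i = 0) ->
  (forall i, i \in s -> i \notin r -> F i = 0) ->
  \sum_(i <- r) F i = \sum_(i <- s) F i.
Proof.
have restr (r' s' : seq I) : (forall i, i \in r' -> i \notin s' -> F i = 0) ->
    \sum_(i <- r') F i = \sum_(i <- [seq i <- r' | i \in s']) F i.
  move=> F0; rewrite big_filter [RHS]big_mkcond/=; apply: eq_big_seq => i ir.
  by case: ifPn => // /(F0 _ ir).
move=> ur us Fr Fs; rewrite (restr r s)// (restr s r)//.
apply: perm_big; apply: uniq_perm; rewrite ?filter_uniq// => i.
by rewrite !mem_filter andbC.
Qed.

(** The list [fib z] enumerates the fibre of [pi] over [z]. After exchanging the sums, each [x] in
    [r] is counted once, at [z = pi x]. *)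
Lemma sum_fibres (V : nmodType) (S W : eqType) (pi : S -> W)
    (fib : W -> seq S) (r : seq S) (s : seq W) (F : S -> V) :
  (forall z, uniq (fib z)) -> (forall z x, (x \in fib z) = (pi x == z)) ->
  uniq r -> uniq s ->
  (forall x, x \in r -> pi x \notin s -> F x = 0) ->
  (forall x, x \notin r -> F x = 0) ->
  \sum_(x <- r) F x = \sum_(z <- s) \sum_(x <- fib z) F x.
Proof.
move=> fib_uniq mem_fib ur us Fs Fr.
have -> : \sum_(z <- s) \sum_(x <- fib z) F x =
    \sum_(z <- s) \sum_(x <- r | pi x == z) F x.
  apply: eq_bigr => z _; rewrite -(big_filter _ (fun x => pi x == z)).
  apply: eq_sum_supp => //; rewrite ?filter_uniq// => x.
    by rewrite mem_filter mem_fib => ->/= /Fr.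
  by rewrite mem_filter mem_fib => /andP[->].
rewrite (exchange_big_dep predT)//=; apply: eq_big_seq => x xr.
have [xs|/Fs->//] := boolP (pi x \in s); last by rewrite big1.
rewrite -big_filter (eq_sum_supp (s := [:: pi x]))// ?filter_uniq//.
- by rewrite big_seq1.
- by move=> z; rewrite mem_filter inE eq_sym => /andP[->].
- by move=> z; rewrite inE mem_filter => /eqP->; rewrite eqxx xs.
Qed.

Lemma esum_split (R : realType) (S : choiceType) (r : seq S) (a : S -> R) :
  uniq r -> (forall u, 0 <= a u) ->
  (\esum_(u in [set: S]) (a u)%:E =
   (\sum_(u <- r) a u)%:E + \esum_(u in ~` [set` r]) (a u)%:E)%E.
Proof.
move=> ur a0; rewrite (esumID [set` r]); last by move=> i _; rewrite lee_fin.
rewrite !setTI; congr (_ + _)%E.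
rewrite esum_fset//; last by move=> i _; rewrite lee_fin.
by rewrite -fsbig_seq// sumEFin.
Qed.

Lemma cvg_sum (R : realType) (T I : Type) (F : set_system T) (FF : Filter F)
    (r : seq I) (f : I -> T -> R) (l : I -> R) :
  (forall i, f i x @[x --> F] --> l i) ->
  \sum_(i <- r) f i x @[x --> F] --> \sum_(i <- r) l i.
Proof.
move=> fl; elim: r => [|i r IH].
  by under eq_fun do rewrite big_nil; rewrite big_nil; exact: cvg_cst.
by under eq_fun do rewrite big_cons; rewrite big_cons; exact: cvgD.
Qed.

(** * First-order expansion of a transition function *)

Section TransitionFunction.
Variables (R : realType) (S : countType) (p : R -> S -> S -> R).
Hypothesis tp : transition_function p.

Lemma tf_partial_sum_le1 (t : R) x r : 0 <= t -> uniq r ->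
  \sum_(u <- r) p t x u <= 1.
Proof.
move=> t0 ur; have p0 u := tf_ge0 tp x u t0.
have := tf_sum1 tp x t0; rewrite (esum_split ur)// => e.
rewrite -lee_fin -e leeDl//; apply: esum_ge0 => u _; rewrite lee_fin.
exact: p0.
Qed.

Lemma tf_le1 (t : R) x y : 0 <= t -> p t x y <= 1.
Proof.
by move=> t0; have := tf_partial_sum_le1 x t0 (isT : uniq [:: y]); rewrite big_seq1.
Qed.

Variables (Q : S -> S -> R) (supp : S -> seq S).
Hypothesis pQ : has_Qmatrix p Q.
Hypothesis supp_uniq : forall x, uniq (supp x).
Hypothesis mem_supp : forall x, x \in supp x.
Hypothesis Q_supp0 : forall x, \sum_(u <- supp x) Q x u = 0.

Lemma Qmatrix_expansion x (r : seq S) (e : R) : 0 < e ->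
  \forall h \near 0^'+, \sum_(u <- r) `|p h x u - (x == u)%:R - h * Q x u| <= h * e.
Proof.
move=> e0.
have H : (fun h : R => \sum_(u <- r) `|(p h x u - (x == u)%:R) / h - Q x u|) @ 0^'+ --> (0 : R).
  rewrite -[X in _ --> X](@big1_eq R 0 +%R _ r xpredT).
  apply: cvg_sum => u; rewrite -[X in _ --> X](_ : `|Q x u - Q x u| = 0).
    apply: (@cvg_norm _ _ _ (0^'+) _ (fun h => (p h x u - (x == u)%:R) / h - Q x u)).
    by apply: cvgB; [exact: pQ|exact: cvg_cst].
  by rewrite subrr normr0.
have /cvgrPdist_le/(_ _ e0) := H.
apply: filterS2 (nbhs_right_gt 0) => h h0.
rewrite sub0r normrN ger0_norm ?sumr_ge0// => le_e.
have -> : \sum_(u <- r) `|p h x u - (x == u)%:R - h * Q x u| =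
    h * \sum_(u <- r) `|(p h x u - (x == u)%:R) / h - Q x u|.
  rewrite mulr_sumr; apply: eq_bigr => u _.
  by rewrite -[X in _ = X * _](gtr0_norm h0) -normrM mulrBr mulrCA divff ?mulr1// gt_eqF.
by rewrite ler_pM2l.
Qed.

(** As the row sums of [Q] vanish over [supp x], the mass that [p h x] puts
    outside [supp x] is [o(h)]; hence the uniformity in [t] and [y]. *)
Lemma backward_expansion x (e : R) : 0 < e ->
  \forall h \near 0^'+, forall t y, 0 <= t ->
  `|p (t + h) x y - p t x y - h * \sum_(u <- supp x) Q x u * p t u y| <= h * e.
Proof.
(* One half of the error is spent on [supp x], the other on the mass outside it. *)
move=> e0; have e20 : 0 < e / 2 by rewrite divr_gt0.
apply: filterS2 (nbhs_right_gt 0) (Qmatrix_expansion x (supp x) e20) => h h0.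
set E := \sum_(u <- _) _ => leE t y t0.
have {}h0 := ltW h0.
have pt0 u : 0 <= p t u y := tf_ge0 tp u y t0.
have ph0 u : 0 <= p h x u := tf_ge0 tp x u h0.
have tailE := tf_sum1 tp x h0; rewrite (esum_split (supp_uniq x))// in tailE.
have := tf_add tp x y h0 t0.
rewrite (esum_split (supp_uniq x)) => [|u]; last exact: mulr_ge0.
set T := esum _ _ in tailE *; set T' := esum _ _ => addE.
have T'0 : (0 <= T')%E by apply: esum_ge0 => u _; rewrite lee_fin mulr_ge0.
have T'T : (T' <= T)%E.
  apply: le_esum => u _; rewrite lee_fin ler_piMr// tf_le1//.
have : (T = (1 - \sum_(u <- supp x) p h x u)%:E)%E.
  by rewrite EFinB -tailE addeAC subee ?add0e.
move=> {}tailE; rewrite {}tailE {T} in T'T.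
have : T' \is a fin_num by rewrite ge0_fin_numE// (le_lt_trans T'T)// ltry.
case: T' T'0 T'T addE => // r; rewrite !lee_fin => r0 r1 [addE] _.
have -> : p (t + h) x y - p t x y - h * \sum_(u <- supp x) Q x u * p t u y =
    \sum_(u <- supp x) (p h x u - (x == u)%:R - h * Q x u) * p t u y + r.
  rewrite [t + h]addrC addE.
  have -> : p t x y = \sum_(u <- supp x) (x == u)%:R * p t u y.
    rewrite (bigD1_seq x)//= eqxx mul1r big1 ?addr0// => u.
    by rewrite eq_sym => /negPf->; rewrite mul0r.
  rewrite mulr_sumr [X in X - _ = _]addrAC [LHS]addrAC; congr (_ + _).
  by rewrite -!sumrB; apply: eq_bigr => u _; ring.
(* Since [p h x] has mass 1 and row [x] of [Q] sums to 0 over [supp x], the escaping mass is minus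
   the sum of the expansion errors, hence at most [E]. *)
have rE : r <= E.
  apply: (le_trans r1); rewrite -(ger0_norm (le_trans r0 r1)) distrC.
  have -> : \sum_(u <- supp x) p h x u - 1 =
      \sum_(u <- supp x) (p h x u - (x == u)%:R - h * Q x u).
    rewrite !sumrB -mulr_sumr Q_supp0 mulr0 subr0; congr (_ - _).
    rewrite (bigD1_seq x)//= eqxx big1 ?addr0// => u.
    by rewrite eq_sym => /negPf->.
  exact: ler_norm_sum.
rewrite (le_trans (ler_normD _ _))// (ger0_norm r0).
have -> : h * e = h * (e / 2) + h * (e / 2) by field.
apply: lerD; last exact: le_trans leE.
apply: le_trans leE; rewrite (le_trans (ler_norm_sum _ _ _))//.
apply: ler_sum => u _; rewrite normrM ler_piMr// ger0_norm// tf_le1//.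
Qed.
End TransitionFunction.

(** A Gronwall argument. Small increments add up to [s * (C * K + e)] over a time [s]; on a window
    with [s * C <= 1 / 2] that starts from 0, any bound on [D] can therefore be halved indefinitely.
    Such windows cover all times. *)
Lemma bounded_linear_growth_eq0 (R : realType) (W : Type) (D : R -> W -> R) (C B : R) :
  0 <= C -> (forall t z, 0 <= t -> `|D t z| <= B) -> (forall z, D 0 z = 0) ->
  (forall z e, 0 < e -> \forall h \near 0^'+, forall t K, 0 <= t ->
    (forall z', `|D t z'| <= K) -> `|D (t + h) z - D t z| <= h * (C * K + e)) ->
  forall t z, 0 <= t -> D t z = 0.
Proof.
move=> C0 DB D0 DH.
have steps z e s0 s K : 0 < e -> 0 <= s0 -> 0 < s -> 
    (forall z s', s0 <= s' <= s0 + s -> `|D s' z| <= K) ->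
    `|D (s0 + s) z - D s0 z| <= s * (C * K + e).
  move=> e0 s00 s_gt0 DK.
  have [/= d d0 Hd] := DH z e e0.
  (* This makes the mesh [s / N] smaller than [d], the range in which the increment bound holds for
     this [z]. *)
  pose N := (Num.truncn (s / d)).+1.
  have N0 : (0 : R) < N%:R by rewrite ltr0n.
  pose h := s / N%:R.
  have h0 : 0 < h by rewrite divr_gt0.
  have hd : h < d.
    rewrite /h ltr_pdivrMr// mulrC -ltr_pdivrMr//.
    exact: truncnS_gt.
  have hN : h * N%:R = s by rewrite /h mulfVK// gt_eqF.
  have Hj (j : nat) : (j <= N)%N ->
      `|D (s0 + h * j%:R) z - D s0 z| <= (h * j%:R) * (C * K + e).
    elim: j => [|j IH] jN; first by rewrite !(mulr0, addr0, mul0r) subrr normr0.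
    have -> : s0 + h * j.+1%:R = s0 + h * j%:R + h.
      by rewrite -natr1 mulrDr mulr1 addrA.
    rewrite -(subrKA (D (s0 + h * j%:R) z)) (le_trans (ler_normD _ _))//.
    rewrite -natr1 [h * (_ + 1)]mulrDr mulr1 mulrDl addrC lerD ?IH 1?ltnW//.
    have j0 : 0 <= h * j%:R by rewrite mulr_ge0// ltW.
    apply: Hd => //=.
    - by rewrite sub0r normrN gtr0_norm.
    - exact: addr_ge0.
    - move=> z'; apply: DK; rewrite lerDl j0/= lerD2l -hN ler_pM2l// ler_nat.
      exact: ltnW.
  by rewrite -{1 2}hN; exact: Hj.
pose a : R := (2 * (C + 1))^-1.
have a0 : 0 < a by rewrite invr_gt0; nra.
have aC : a * C <= 2^-1.
  rewrite /a invfM -mulrA -[leRHS]mulr1 ler_wpM2l// mulrC ler_pdivrMr; lra.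
have local s0 : 0 <= s0 -> (forall z, D s0 z = 0) ->
    forall s z, s0 <= s <= s0 + a -> D s z = 0.
  move=> s00 Ds0 s1 z1 s1a.
  (* Each round feeds the previous bound, uniform in [z] and in the window, back into [steps]. *)
  have H k s z : s0 <= s <= s0 + a -> `|D s z| <= 2^-1 ^+ k * B.
    elim: k s z => [|k IH] s z /andP[s0s ss0].
      by rewrite expr0 mul1r DB// (le_trans s00).
    move: s0s; rewrite le_eqVlt => /predU1P[<-|s0s].
      have B0 : 0 <= B by apply: le_trans (DB 0 z (lexx _)).
      by rewrite Ds0 normr0 mulr_ge0// exprn_ge0.
    have ss : 0 < s - s0 by rewrite subr_gt0.
    have K0 : 0 <= 2^-1 ^+ k * B.
      by apply: le_trans (IH s0 z _); rewrite // lexx lerDl ltW.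
    apply/ler_addgt0Pr => e e0.
    have ea : 0 < e / a by rewrite divr_gt0.
    have := steps z (e / a) s0 (s - s0) (2^-1 ^+ k * B) ea s00 ss.
    rewrite addrC subrK Ds0 subr0 => /(_ _)/le_trans; apply.
      move=> z' s' /andP[s0s' s's]; apply: IH; rewrite s0s'/=.
      exact: le_trans ss0.
    rewrite (@le_trans _ _ (a * (C * (2^-1 ^+ k * B) + e / a)))//.
      apply: ler_wpM2r; last by rewrite lerBlDl.
      by apply: addr_ge0; [exact: mulr_ge0|exact: ltW].
    rewrite mulrDr [a * (e / a)]mulrC divfK ?gt_eqF// lerD2r exprS -mulrA mulrA.
    by apply: ler_wpM2r.
  apply/eqP; rewrite -normr_eq0 eq_le normr_ge0 andbT.
  have lim0 : (fun k : nat => 2^-1 ^+ k * B) @ \oo --> (0 : R).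
    rewrite -(mul0r B); apply: cvgMl; apply: cvg_expr.
    by rewrite ger0_norm// invf_lt1// ltr1n.
  rewrite -(cvg_lim _ lim0)//; apply: limr_ge; first by apply/cvg_ex; exists 0.
  by apply: nearW => k; exact: H.
have grid (m : nat) s z : 0 <= s <= a * m%:R -> D s z = 0.
  elim: m s z => [|m IH] s z /andP[s0 sm].
    by rewrite (_ : s = 0) ?D0//; apply/eqP; rewrite eq_le s0 andbT -(mulr0 a).
  have [sam|ams] := leP s (a * m%:R); first by apply: IH; rewrite s0.
  have am0 : 0 <= a * m%:R by rewrite mulr_ge0// ltW.
  apply: (local (a * m%:R)) => //; first by move=> z'; rewrite IH// lexx andbT.
  by rewrite (ltW ams)/= -[X in _ + X]mulr1 -mulrDr natr1.
move=> t z t0; apply: (grid (Num.truncn (t / a)).+1); rewrite t0/= mulrC -ler_pdivrMr//.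
by rewrite ltW// truncnS_gt.
Qed.

(** * Markov functions *)

Lemma esumZl (R : realType) (S : choiceType) (D : set S) (r : R) (a : S -> \bar R) :
  0 <= r -> (forall x, 0 <= a x)%E ->
  (\esum_(i in D) (r%:E * a i) = r%:E * \esum_(i in D) a i)%E.
Proof.
move=> r0 a0; rewrite /esum -ereal_supZl//; last first.
  by apply/set0P; exists (\sum_(x \in set0) a x)%E; exists set0 => //; exact: fsets_set0.
rewrite image_comp; congr ereal_sup; apply: eq_imagel => A _ /=.
by rewrite ge0_mule_fsumr.
Qed.

Lemma near_all_seq (T : Type) (F : set_system T) (FF : Filter F) (J : eqType)
    (r : seq J) (A : J -> T -> Prop) :
  (forall i, \forall x \near F, A i x) ->
  \forall x \near F, forall i, i \in r -> A i x.
Proof.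
move=> FA; elim: r => [|j r IH]; first exact: nearW.
apply: filterS2 (FA j) IH => x Aj Ar i.
by rewrite inE => /predU1P[->|/Ar].
Qed.

(** * Conservative matrices with finitely supported rows *)

Section Conservative.
Variables (R : realType) (S : countType) (off : S -> S -> R) (x : S) (s : seq S).
Hypothesis s_uniq : uniq s.
Hypothesis off_out : forall u, u \notin s -> u != x -> off x u = 0.

Lemma conservative_diag :
  conservative off x x = - \sum_(u <- s | u != x) off x u.
Proof.
rewrite /conservative eqxx; congr (- _); apply/esym.
by apply: (@bigfs _ _ _ _ _ [pred u | u != x]) => // u /= ux us; exact: off_out.
Qed.

Lemma conservative_sum0 : x \in s -> \sum_(u <- s) conservative off x u = 0.
Proof.
move=> xs; rewrite (bigD1_seq x)//= conservative_diag addrC.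
apply/eqP; rewrite subr_eq0; apply/eqP; apply: eq_bigr => u ux.
by rewrite /conservative eq_sym (negPf ux).
Qed.

Lemma conservative_norm_sum : x \in s -> (forall u, 0 <= off x u) ->
  \sum_(u <- s) `|conservative off x u| = 2 * \sum_(u <- s | u != x) off x u.
Proof.
move=> xs off0; rewrite (bigD1_seq x)//= conservative_diag normrN ger0_norm ?sumr_ge0//.
rewrite mulr_natl mulr2n; congr (_ + _); apply: eq_bigr => u ux.
by rewrite /conservative eq_sym (negPf ux) ger0_norm.
Qed.

End Conservative.

(** * Two Q-matrices intertwined by a link with finite fibres *)

Section Intertwining.
Variables (R : realType) (S W : countType) (pi : S -> W) (fib : W -> seq S).
Variables (M : S -> R) (Q : S -> S -> R) (Q' : W -> W -> R).
Variables (supp : S -> seq S) (C : R).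
Hypothesis fib_uniq : forall z, uniq (fib z).
Hypothesis mem_fib : forall z x, (x \in fib z) = (pi x == z).
Hypothesis M_ge0 : forall x, 0 <= M x.
Hypothesis M_sum1 : forall z, \sum_(x <- fib z) M x = 1.
Hypothesis supp_uniq : forall x, uniq (supp x).
Hypothesis mem_supp : forall x, x \in supp x.
Hypothesis Q_out : forall x u, u \notin supp x -> Q x u = 0.
Hypothesis Q_sum0 : forall x, \sum_(u <- supp x) Q x u = 0.
Hypothesis Q_bound : forall x, \sum_(u <- supp x) `|Q x u| <= C.

(** A finite list outside of which row [z] of the product [M Q] vanishes; [image z] is its
    projection to [W]. *)
Let reach z := undup (flatten [seq supp x | x <- fib z]).
Let image z := undup (map pi (reach z)).

Let reach_uniq z : uniq (reach z). Proof. exact: undup_uniq. Qed.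

Let supp_reach z x : x \in fib z -> {subset supp x <= reach z}.
Proof.
by move=> xz u ux; rewrite mem_undup; apply/flattenP; exists (supp x) => //; exact: map_f.
Qed.

Let sum_reach z x (F : S -> R) : x \in fib z -> (forall u, u \notin supp x -> F u = 0) ->
  \sum_(u <- supp x) F u = \sum_(u <- reach z) F u.
Proof.
move=> xz F0; apply: eq_sum_supp => // u; last by move=> _ /F0.
by move=> /(supp_reach xz)->.
Qed.

Let sum_image z (F : S -> R) : (forall u, u \notin reach z -> F u = 0) ->
  \sum_(u <- reach z) F u = \sum_(z' <- image z) \sum_(u <- fib z') F u.
Proof.
move=> F0; apply: (sum_fibres fib_uniq mem_fib) => //; first exact: undup_uniq.
by move=> x xr; rewrite mem_undup map_f.
Qed.

Let Q_reach z u : u \notin reach z -> \sum_(x <- fib z) M x * Q x u = 0.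
Proof.
move=> uz; rewrite big_seq big1// => x xz; rewrite Q_out ?mulr0//.
by apply: contra uz; exact: supp_reach.
Qed.

Let sum_image_link z :
  \sum_(z' <- image z) \sum_(u <- fib z') \sum_(x <- fib z) M x * Q x u = 0.
Proof.
rewrite -sum_image => [|u uz]; last by rewrite Q_reach.
rewrite exchange_big/= big_seq big1// => x xz.
rewrite -mulr_sumr -(sum_reach xz) ?Q_sum0 ?mulr0// => u; exact: Q_out.
Qed.

(** Only off-diagonal entries need to be matched: summing the intertwining
    relation over all targets gives the diagonal entries, provided that on each
    fibre the link is a left eigenvector of the diagonal block. *)
Lemma conservative_intertwining (off : W -> W -> R) (kappa : W -> R) :
  (forall z y, pi y != z -> \sum_(x <- fib z) M x * Q x y = off z (pi y) * M y) ->
  (forall y, \sum_(x <- fib (pi y)) M x * Q x y = - kappa (pi y) * M y) ->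
  forall z y, \sum_(x <- fib z) M x * Q x y = conservative off z (pi y) * M y.
Proof.
move=> Hoff Hdiag z y; have [<-|yz] := eqVneq (pi y) z; last first.
  by rewrite Hoff// /conservative eq_sym (negPf yz).
rewrite Hdiag; congr (_ * _); set w := pi y.
have fib_off z' : z' != w -> \sum_(u <- fib z') \sum_(x <- fib w) M x * Q x u = off w z'.
  move=> z'w; rewrite -[RHS]mulr1 -(M_sum1 z') mulr_sumr; apply: eq_big_seq => u.
  by rewrite mem_fib => /eqP uz'; rewrite Hoff uz'.
rewrite (@conservative_diag _ _ _ _ (image w)); first last.
- move=> z' z'w /[dup] /fib_off <- _; rewrite big_seq big1// => u.
  rewrite mem_fib => /eqP uz'; rewrite Q_reach//; apply: contra z'w => ur.
  by rewrite mem_undup -uz' map_f.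
- exact: undup_uniq.
have := sum_image_link w; rewrite (bigD1_seq w)/=; last exact: undup_uniq.
  rewrite (eq_big_seq (fun u => - kappa w * M u)); last first.
    by move=> u; rewrite mem_fib => /eqP uw; rewrite -uw Hdiag.
  rewrite -mulr_sumr M_sum1 mulr1 (eq_bigr (off w))// => /eqP.
  by rewrite addrC subr_eq0 => /eqP ->.
rewrite mem_undup map_f// mem_undup; apply/flattenP; exists (supp y) => //.
by apply: map_f; rewrite mem_fib.
Qed.

Hypothesis intertwining : forall z y,
  \sum_(x <- fib z) M x * Q x y = Q' z (pi y) * M y.

(** The relation [M Q = Q' M] applied to a function [f]; all sums are finite, so they can be
    exchanged. *)
Lemma intertwining_apply z (f : S -> R) :
  \sum_(x <- fib z) M x * \sum_(u <- supp x) Q x u * f u =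
  \sum_(z' <- image z) Q' z z' * \sum_(u <- fib z') M u * f u.
Proof.
transitivity (\sum_(u <- reach z) (\sum_(x <- fib z) M x * Q x u) * f u).
  under [RHS]eq_bigr do rewrite mulr_suml.
  rewrite [RHS]exchange_big/=; apply: eq_big_seq => x xz.
  rewrite (sum_reach xz) => [|u ux]; last by rewrite Q_out ?mul0r.
  by rewrite mulr_sumr; apply: eq_bigr => u _; rewrite mulrA.
rewrite sum_image => [|u uz]; last by rewrite Q_reach ?mul0r.
apply: eq_bigr => z' _; rewrite mulr_sumr; apply: eq_big_seq => u.
by rewrite mem_fib intertwining => /eqP->; rewrite mulrA.
Qed.

(** As [M] is a probability on each fibre, the row of [Q'] has the same absolute sum as that of
    [M Q], which is an average of rows of [Q]. *)
Lemma intertwining_bound z : \sum_(z' <- image z) `|Q' z z'| <= C.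
Proof.
have -> : \sum_(z' <- image z) `|Q' z z'| =
    \sum_(u <- reach z) `|\sum_(x <- fib z) M x * Q x u|.
  rewrite sum_image => [|u uz]; last by rewrite Q_reach ?normr0.
  apply: eq_bigr => z' _; rewrite -[LHS]mulr1 -(M_sum1 z') mulr_sumr.
  apply: eq_big_seq => u; rewrite mem_fib intertwining => /eqP->.
  by rewrite normrM (ger0_norm (M_ge0 u)).
apply: (@le_trans _ _ (\sum_(u <- reach z) \sum_(x <- fib z) M x * `|Q x u|)).
  apply: ler_sum => u _; rewrite (le_trans (ler_norm_sum _ _ _))//.
  by apply: ler_sum => x _; rewrite normrM (ger0_norm (M_ge0 x)).
rewrite exchange_big/= -[leRHS]mul1r -(M_sum1 z) mulr_suml big_seq [leRHS]big_seq.
apply: ler_sum => x xz; rewrite -mulr_sumr ler_wpM2l//.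
by rewrite -(sum_reach xz)// => u ux; rewrite Q_out ?normr0.
Qed.

Let C_ge0 : inhabited S -> 0 <= C.
Proof. by case=> x; apply: le_trans (Q_bound x); apply: sumr_ge0. Qed.

(** * The transition function of the projected process *)

Section Lumping.
Variable p : R -> S -> S -> R.
Hypothesis tp : transition_function p.
Hypothesis pQ : has_Qmatrix p Q.

(** The law of the projection at time [t] when the start is drawn from the link over [z]. *)
Definition lumped (t : R) (z z' : W) : R :=
  \sum_(y <- fib z') \sum_(x <- fib z) M x * p t x y.

(** For [pi y = pi y'], the function [D t z] below solves the backward equation
    of [Q'] with initial value 0. *)
Lemma link_transition t z y : 0 <= t ->
  \sum_(x <- fib z) M x * p t x y = lumped t z (pi y) * M y.
Proof.
move=> t0.
(* Constancy of [M p_t (z, y) / M y] along a fibre, cross-multiplied because [M] may vanish. Summing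
   over [y'] in the fibre gives the claim. *)
suff H y' : pi y' = pi y -> (\sum_(x <- fib z) M x * p t x y) * M y' =
    (\sum_(x <- fib z) M x * p t x y') * M y.
  rewrite -[LHS]mulr1 -(M_sum1 (pi y)) mulr_sumr mulr_suml.
  by apply: eq_big_seq => y'; rewrite mem_fib => /eqP/H.
move=> yy'.
pose f t x := M y' * p t x y - M y * p t x y'.
pose D t z := \sum_(x <- fib z) M x * f t x.
suff D0 : D t z = 0.
  apply/eqP; rewrite -subr_eq0 -[eqbRHS]D0 /D /f !mulr_suml -sumrB.
  by apply/eqP; apply: eq_bigr => x _; ring.
have My := M_ge0 y; have My' := M_ge0 y'.
apply: (@bounded_linear_growth_eq0 _ _ D C (M y' + M y)) => //.
- by apply: C_ge0; constructor.
- move=> {t0 z}t z t0; rewrite /D (le_trans (ler_norm_sum _ _ _))//.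
  rewrite -[leRHS]mul1r -(M_sum1 z) mulr_suml; apply: ler_sum => x _.
  rewrite normrM (ger0_norm (M_ge0 x)) ler_wpM2l// (le_trans (ler_normB _ _))//.
  rewrite !normrM (ger0_norm My) (ger0_norm My') !ger0_norm ?(tf_ge0 tp)//.
  by rewrite lerD// ler_piMr// tf_le1.
- move=> z'; rewrite /D /f; under eq_bigr do rewrite !(tf_zero tp).
  have sum_fib v : \sum_(x <- fib z') M x * (x == v)%:R = M v * (pi v == z')%:R.
    rewrite -mem_fib; have [vz|vz] := boolP (v \in fib z').
      rewrite (bigD1_seq v)//= eqxx big1 ?addr0// => u /negPf->.
      exact: mulr0.
    rewrite mulr0 big_seq big1// => u uz; have [uv|] := eqVneq u v.
      by rewrite -uv uz in vz.
    by rewrite mulr0.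
  rewrite (eq_bigr (fun x => M y' * (M x * (x == y)%:R) - M y * (M x * (x == y')%:R))).
    by rewrite sumrB -!mulr_sumr !sum_fib yy'; ring.
  by move=> x _; ring.
(* The errors at [y] and [y'] enter with weights [M y'] and [M y], so tolerance [e / K] for each
   suffices; the 1 keeps [K] positive. *)
move=> {t t0 z}z e e0; set K := M y' + M y + 1.
have K0 : 0 < K by rewrite /K; lra.
have eK : 0 < e / K by rewrite divr_gt0.
have near_fib : \forall h \near 0^'+, forall x, x \in fib z -> forall t y, 0 <= t ->
    `|p (t + h) x y - p t x y - h * \sum_(u <- supp x) Q x u * p t u y| <= h * (e / K).
  by apply: near_all_seq => x; exact: backward_expansion.
apply: filterS2 (nbhs_right_gt 0) near_fib => h h0 Hh t L t0 DL.
(* The intertwining turns the averaged backward equation of [Q] into that of [Q']; the last sum is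
   the averaged remainder. *)
have -> : D (t + h) z - D t z = h * (\sum_(z' <- image z) Q' z z' * D t z') +
   \sum_(x <- fib z) M x * (f (t + h) x - f t x - h * \sum_(u <- supp x) Q x u * f t u).
  rewrite -intertwining_apply mulr_sumr -big_split/= /D -sumrB.
  by apply: eq_bigr => x _; ring.
rewrite (le_trans (ler_normD _ _))// mulrDr lerD//.
  rewrite normrM (gtr0_norm h0) ler_pM2l// (le_trans (ler_norm_sum _ _ _))//.
  apply: (@le_trans _ _ (\sum_(z' <- image z) `|Q' z z'| * L)).
    by apply: ler_sum => z' _; rewrite normrM ler_wpM2l.
  rewrite -mulr_suml ler_wpM2r ?intertwining_bound//.
  exact: le_trans (DL z).
rewrite (le_trans (ler_norm_sum _ _ _))// -[leRHS]mul1r -(M_sum1 z) mulr_suml.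
rewrite big_seq [leRHS]big_seq; apply: ler_sum => x xz.
rewrite normrM (ger0_norm (M_ge0 x)) ler_wpM2l//.
have -> : f (t + h) x - f t x - h * (\sum_(u <- supp x) Q x u * f t u) =
   M y' * (p (t + h) x y - p t x y - h * \sum_(u <- supp x) Q x u * p t u y) -
   M y * (p (t + h) x y' - p t x y' - h * \sum_(u <- supp x) Q x u * p t u y').
  have -> : \sum_(u <- supp x) Q x u * f t u =
      M y' * (\sum_(u <- supp x) Q x u * p t u y) -
      M y * (\sum_(u <- supp x) Q x u * p t u y').
    by rewrite !mulr_sumr -sumrB; apply: eq_bigr => u _; rewrite /f; ring.
  by rewrite /f; ring.
rewrite (le_trans (ler_normB _ _))// !normrM (ger0_norm My) (ger0_norm My').
apply: (@le_trans _ _ (M y' * (h * (e / K)) + M y * (h * (e / K)))).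
  by rewrite lerD// ler_wpM2l//; apply: Hh.
rewrite -mulrDl (mulrC (_ + _)) -mulrA ler_pM2l// -mulrA ger_pMr// mulrC.
by rewrite ler_pdivrMr// /K; lra.
Qed.

Let sum_delta z z' :
  \sum_(y <- fib z') \sum_(x <- fib z) M x * (x == y)%:R = (z == z')%:R.
Proof.
rewrite -[RHS]mulr1 -[X in _ = _ * X](M_sum1 z') mulr_sumr; apply: eq_big_seq => y.
rewrite mem_fib => /eqP <-; have [zy|zy] := eqVneq z (pi y).
  have yz : y \in fib z by rewrite mem_fib zy.
  rewrite (bigD1_seq y)//= eqxx big1 ?addr0 ?(mulrC 1)// => x /negPf->.
  exact: mulr0.
rewrite mul0r big_seq big1// => x; rewrite mem_fib => /eqP xz.
have [xy|] := eqVneq x y; last by rewrite mulr0.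
by rewrite -xz xy eqxx in zy.
Qed.

(** Fibres are finite, so the derivative at 0 passes through the sums; it is [M Q] summed over the
    target fibre, which is [Q']. *)
Lemma lumped_Qmatrix : has_Qmatrix lumped Q'.
Proof.
move=> z z'.
have -> : Q' z z' = \sum_(y <- fib z') \sum_(x <- fib z) M x * Q x y.
  rewrite -[LHS]mulr1 -(M_sum1 z') mulr_sumr; apply: eq_big_seq => y.
  by rewrite intertwining mem_fib => /eqP->.
rewrite (_ : (fun t => _) = fun t => \sum_(y <- fib z') \sum_(x <- fib z)
    M x * ((p t x y - (x == y)%:R) / t)).
  by apply: cvg_sum => y; apply: cvg_sum => x; apply: cvgMr; exact: pQ.
apply/funext => t.
rewrite -sum_delta -sumrB mulr_suml; apply: eq_bigr => y _.
rewrite -sumrB mulr_suml; apply: eq_bigr => x _; ring.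
Qed.

Lemma esum_fibres (a : S -> R) : (forall u, 0 <= a u) ->
  (\esum_(u in [set: S]) (a u)%:E =
   \esum_(z in [set: W]) (\sum_(u <- fib z) a u)%:E)%E.
Proof.
move=> a0; have a0' u : (0 <= (a u)%:E)%E by rewrite lee_fin.
transitivity (\esum_(z in [set: W]) \esum_(u in [set` fib z]) (a u)%:E)%E.
  rewrite esum_esum//; apply/esym.
  rewrite (@reindex_esum _ _ _ [set: S] _ (fun u => (pi u, u)))//; split.
  - by move=> u _ /=; rewrite mem_fib.
  - by move=> u u' _ _ [].
  - by move=> [z u] [_ /=]; rewrite mem_fib => /eqP <-; exists u.
apply: eq_esum => z _; rewrite esum_fset//; last exact: finite_seq.
by rewrite -fsbig_seq// sumEFin.
Qed.

(** For the semigroup property, [link_transition] says that at the intermediate time the law is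
    again a mixture of links, so the second step starts afresh from the link. *)
Lemma lumped_transition_function : transition_function lumped.
Proof.
split.
- move=> t z z' t0; apply: sumr_ge0 => y _; apply: sumr_ge0 => x _.
  by rewrite mulr_ge0// (tf_ge0 tp).
- move=> t z t0; rewrite /lumped -(@esum_fibres (fun y => \sum_(x <- fib z) M x * p t x y)).
    under eq_esum do rewrite -sumEFin.
    rewrite esum_sum => [|y x _ _]; last by rewrite lee_fin mulr_ge0// (tf_ge0 tp).
    rewrite -[RHS]/(1%:E) -(M_sum1 z) -sumEFin; apply: eq_bigr => x _.
    under eq_esum do rewrite EFinM.
    rewrite esumZl// => [|y]; last by rewrite lee_fin (tf_ge0 tp).
    by rewrite (tf_sum1 tp)// mule1.
  by move=> y; apply: sumr_ge0 => x _; rewrite mulr_ge0// (tf_ge0 tp).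
- move=> z z'; rewrite -sum_delta /lumped; apply: eq_bigr => y _; apply: eq_bigr => x _.
  by rewrite (tf_zero tp).
- move=> s t z z' s0 t0.
  rewrite /lumped -sumEFin.
  under eq_bigr do rewrite -sumEFin.
  have F0 (x u y : S) : 0 <= p s x u * p t u y.
    by rewrite mulr_ge0// (tf_ge0 tp).
  transitivity (\esum_(u in [set: S])
     (\sum_(y <- fib z') \sum_(x <- fib z) M x * (p s x u * p t u y))%:E)%E.
    under [RHS]eq_esum do rewrite -sumEFin.
    rewrite esum_sum => [|u y _ _]; last first.
      by rewrite lee_fin; apply: sumr_ge0 => x _; exact: mulr_ge0.
    apply: eq_bigr => y _; under [RHS]eq_esum do rewrite -sumEFin.
    rewrite esum_sum => [|u x _ _]; last by rewrite lee_fin mulr_ge0.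
    apply: eq_bigr => x _; rewrite EFinM (tf_add tp)// -esumZl//.
    by move=> u; rewrite lee_fin.
  rewrite esum_fibres; last first.
    by move=> u; apply: sumr_ge0 => y _; apply: sumr_ge0 => x _; exact: mulr_ge0.
  apply: eq_esum => w _; congr EFin.
  rewrite -/(lumped s z w) mulr_sumr exchange_big/=; apply: eq_bigr => y _.
  rewrite mulr_sumr; apply: eq_big_seq => u; rewrite mem_fib => /eqP uw.
  under eq_bigr do rewrite mulrA.
  by rewrite -mulr_suml link_transition// uw mulrA.
Qed.

End Lumping.

(** The Markov function theorem of Rogers and Pitman, for finite fibres. *)
Lemma markov_process_link (nu : W -> R) (d : measure_display)
    (T : measurableType d) (P : probability T R) (X : R -> T -> S) :
  markov_process P (fun x => nu (pi x) * M x) Q X ->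
  markov_process P nu Q' (fun t w => pi (X t w)).
Proof.
move=> [mX rcX [p [tp pQ fddX]]].
have fibreE t z : [set w | pi (X t w) = z] =
    \bigcup_(x in [set` fib z]) [set w | X t w = x].
  apply/seteqP; split=> [w /= <-|w [x]/=]; first by exists (X t w); rewrite //= mem_fib.
  by rewrite mem_fib => /eqP <- ->.
have mpiX t z : 0 <= t -> measurable [set w | pi (X t w) = z].
  move=> t0; rewrite fibreE; apply: fin_bigcup_measurable; first exact: finite_seq.
  by move=> x _; exact: mX.
split=> //.
  by move: rcX; apply: filterS => w /= H t /H; apply: filterS => s ->.
exists (lumped p); split; [exact: lumped_transition_function|exact: lumped_Qmatrix|].
move=> m t x t0 tS.
have t_ge0 i : (i <= m)%N -> 0 <= t i.
  elim: i => [|i IH] im; first by rewrite t0.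
  by rewrite (le_trans (IH _))// ?tS// ltnW.
have dt_ge0 i : (i < m)%N -> 0 <= t i.+1 - t i by move=> im; rewrite subr_ge0 tS.
(* Representatives exist because a fibre of mass 1 is not empty. *)
have /choice[xs pi_xs] i : exists s, pi s = x i.
  have := M_sum1 (x i); case E : (fib (x i)) => [|s l].
    by rewrite big_nil => /eqP; rewrite eq_sym oner_eq0.
  by move=> _; exists s; apply/eqP; rewrite -mem_fib E mem_head.
(* A mixed event: only the projection is prescribed before index [k], the full state from [k] on. So
   [E 0] is a cylinder event of [X], and [E m.+1] one of the projection. *)
pose E k (ys : nat -> S) := [set w | forall i, (i <= m)%N ->
  if (i < k)%N then pi (X (t i) w) = pi (ys i) else X (t i) w = ys i].
have mE k ys : measurable (E k ys).
  rewrite (_ : E k ys = \bigcap_(i in [set i | (i <= m)%N])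
     [set w | if (i < k)%N then pi (X (t i) w) = pi (ys i) else X (t i) w = ys i]).
    apply: bigcap_measurable; first by exists 0%N.
    by move=> i /= im; case: (i < k)%N; [exact/mpiX/t_ge0|exact/mX/t_ge0].
  by apply/seteqP; split.
pose upd (ys : nat -> S) k y i := if i == k then y else ys i.
have PES k ys : (k <= m)%N ->
    P (E k.+1 ys) = (\sum_(y <- fib (pi (ys k))) P (E k (upd ys k y)))%E.
  move=> km; have -> : E k.+1 ys = \bigcup_(y in [set` fib (pi (ys k))]) E k (upd ys k y).
    apply/seteqP; split=> w /=.
      move=> H; exists (X (t k) w).
        by rewrite /= mem_fib; have := H k km; rewrite ltnSn => ->.
      move=> i im; have := H i im; rewrite /upd ltnS.
      by case: ltngtP => // ->.
    move=> [y]; rewrite /= mem_fib => /eqP yk H i im; have := H i im.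
    by rewrite /upd ltnS; case: ltngtP => // -> ->.
  rewrite measure_fin_bigcup//; first by rewrite -fsbig_seq.
    exact: finite_seq.
  apply/trivIsetP => y y' _ _ /eqP yy'; apply/seteqP; split=> // w [/(_ k km)] + /(_ k km).
  by rewrite ltnn /upd eqxx => -> /yy'.
(* The probability of [E k ys]: projected steps up to [k], then the link at [ys k], then steps of
   the full chain. *)
pose G k ys := nu (pi (ys 0%N)) *
  (\prod_(0 <= i < k) lumped p (t i.+1 - t i) (pi (ys i)) (pi (ys i.+1))) *
  (M (ys k) * \prod_(k <= i < m) p (t i.+1 - t i) (ys i) (ys i.+1)).
have Gupd k ys y : pi y = pi (ys k) -> G k (upd ys k y) = nu (pi (ys 0%N)) *
  (\prod_(0 <= i < k) lumped p (t i.+1 - t i) (pi (ys i)) (pi (ys i.+1))) *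
  (M y * \prod_(k <= i < m) p (t i.+1 - t i) (upd ys k y i) (ys i.+1)).
  move=> yk; have pi_upd i : pi (upd ys k y i) = pi (ys i).
    by rewrite /upd; case: eqP => // ->.
  rewrite /G pi_upd; congr (_ * _ * _).
    by apply: eq_bigr => i _; rewrite !pi_upd.
  rewrite {1}/upd eqxx; congr (_ * _); rewrite big_nat_cond [RHS]big_nat_cond.
  by apply: eq_bigr => i /andP[/andP[ki _] _]; rewrite {2}/upd gtn_eqF.
have PE k ys : (k <= m)%N -> P (E k ys) = (G k ys)%:E.
  elim: k ys => [|k IH] ys km.
    by rewrite [LHS]fddX// /G big_nil mulr1 -mulrA big_mkord.
  rewrite PES 1?ltnW//.
  under eq_bigr do rewrite IH 1?ltnW//.
  rewrite sumEFin; congr EFin.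
  rewrite (eq_big_seq (fun y => nu (pi (ys 0%N)) *
    (\prod_(0 <= i < k) lumped p (t i.+1 - t i) (pi (ys i)) (pi (ys i.+1))) *
    (\prod_(k.+1 <= i < m) p (t i.+1 - t i) (ys i) (ys i.+1)) *
    (M y * p (t k.+1 - t k) y (ys k.+1)))).
    (* Summing over the state at index [k] turns one step of [p] into a step of [lumped p] and moves
       the link to [ys k.+1]. *)
    rewrite -mulr_sumr link_transition ?dt_ge0// /G big_nat_recr//=; ring.
  move=> y; rewrite mem_fib => /eqP yk; rewrite Gupd// (big_ltn km) {1}/upd eqxx.
  rewrite [X in p _ _ _ * X](eq_big_nat _ _
    (F2 := fun i => p (t i.+1 - t i) (ys i) (ys i.+1))); first ring.
  by move=> i /andP[ki _]; rewrite /upd gtn_eqF.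
transitivity (P (E m.+1 xs)).
  congr (P _); apply/seteqP; split=> w /= H i im; have := H i im; rewrite ltnS im.
    by rewrite pi_xs.
  by rewrite -pi_xs.
rewrite PES//; under eq_bigr do rewrite PE//.
rewrite sumEFin; congr EFin.
rewrite (eq_big_seq (fun y => nu (x 0%N) *
    (\prod_(i < m) lumped p (t i.+1 - t i) (x i) (x i.+1)) * M y)).
  by rewrite -mulr_sumr M_sum1 mulr1.
move=> y; rewrite mem_fib => /eqP ym; rewrite Gupd// (big_geq (leqnn m)) mulr1 big_mkord pi_xs.
by congr (_ * _ * _); apply: eq_bigr => i _; rewrite !pi_xs.
Qed.

End Intertwining.

(** * Chains of pushed particles *)

Section Particles.
Variable n : nat.
Implicit Types (p e u v : particle n) (x y : triangle n).

(** 0-based, unlike [rowp] and [posp]. *)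
Definition prow p : nat := (val p).1.
Definition ppos p : nat := (val p).2.

Lemma prow_lt p : (prow p < n)%N. Proof. exact: ltn_ord. Qed.

Lemma ppos_le p : (ppos p <= prow p)%N. Proof. exact: (valP p). Qed.

Lemma particle_inj u v : prow u = prow v -> ppos u = ppos v -> u = v.
Proof.
move=> a b; apply: val_inj; case: u v a b => [[u1 u2] /= hu] [[v1 v2] /= hv].
by rewrite /prow /ppos /= => a b; congr (_, _); exact: val_inj.
Qed.

Lemma particle_exists (a b : nat) : (a < n)%N -> (b <= a)%N ->
  exists p, prow p = a /\ ppos p = b.
Proof.
move=> an ba; have bn := leq_ltn_trans ba an.
by exists (exist _ (Ordinal an, Ordinal bn) ba).
Qed.

(** Here [p'] is [p] or lies below it in the direction of pushing, along which row and position grow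
    together. The additive form avoids truncated subtraction. *)
Definition diag p p' := (prow p <= prow p')%N && (prow p + ppos p' == prow p' + ppos p)%N.

Lemma interlacingP x : reflect
  (forall u v, prow v = (prow u).+1 ->
     (ppos v = ppos u -> x v <= x u) /\ (ppos v = (ppos u).+1 -> x u <= x v))
  (interlacing x).
Proof.
apply: (iffP forallP) => [H u v r_uv|H u].
  have /forallP/(_ v) := H u; rewrite /rowp /posp -/(prow u) -/(prow v) r_uv eqxx/=.
  rewrite -/(ppos u) -/(ppos v) => /andP[/implyP h1 /implyP h2].
  by split=> e; [apply: h1|apply: h2]; rewrite e.
apply/forallP => v; apply/implyP => /eqP[r_uv].
have [h1 h2] := H u v r_uv.
by apply/andP; split; apply/implyP => /eqP[]; [exact: h1|exact: h2].
Qed.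

Lemma interlacing_left x u v : interlacing x ->
  prow v = (prow u).+1 -> ppos v = ppos u -> x v <= x u.
Proof. by move=> /interlacingP H /H[]. Qed.

Lemma interlacing_right x u v : interlacing x ->
  prow v = (prow u).+1 -> ppos v = (ppos u).+1 -> x u <= x v.
Proof. by move=> /interlacingP H /H[]. Qed.

Lemma diag_refl p : diag p p. Proof. by rewrite /diag leqnn addnC eqxx. Qed.

Lemma diag_trans u p v : diag p u -> diag u v -> diag p v.
Proof. rewrite /diag; lia. Qed.

Lemma diag_pred p p' : diag p p' -> p != p' ->
  exists u, [/\ diag p u, prow p' = (prow u).+1 & ppos p' = (ppos u).+1].
Proof.
move=> d np; have h1 := ppos_le p; have h2 := ppos_le p'; have h3 := prow_lt p'.
have lt : (prow p < prow p')%N.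
  rewrite ltn_neqAle; apply/andP; split; last by case/andP: d.
  apply: contra np => /eqP rr; apply/eqP/particle_inj => //.
  by move: d; rewrite /diag; lia.
have [||u [ur uc]] := @particle_exists (prow p').-1 (ppos p').-1; [lia..|].
by exists u; split; move: d; rewrite /diag; lia.
Qed.

Lemma diag_ind p (A : particle n -> Prop) : A p ->
  (forall u v, diag p u -> A u -> prow v = (prow u).+1 ->
     ppos v = (ppos u).+1 -> A v) ->
  forall p', diag p p' -> A p'.
Proof.
move=> Ap AS p'; move: {2}(prow p') (leqnn (prow p')) => k.
elim: k p' => [|k IH] p' pk d.
  have [<-//|/(diag_pred d)[u [_ e _]]] := eqVneq p p'; lia.
have [<-//|/(diag_pred d)[u [d' r_eq c_eq]]] := eqVneq p p'.
by apply: (AS u) => //; apply: IH => //; lia.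
Qed.

Lemma diag_le x p p' : interlacing x -> diag p p' -> x p <= x p'.
Proof.
move=> ix; move: p'; apply: diag_ind => // u v _ xu r_eq c_eq.
exact: le_trans (interlacing_right ix r_eq c_eq).
Qed.

(** Entries weakly increase down a diagonal, so equal values at both ends force equality in between,
    and each particle pushes the next. *)
Lemma connect_pushes x p p' : interlacing x ->
  connect (pushes x) p p' = diag p p' && (x p == x p').
Proof.
move=> ix; apply/idP/andP => [/connectP[l]|[]].
  elim: l p => [p _ ->|u l IH p /= /andP[pu /IH{}IH] /IH[d /eqP xu]].
    by rewrite diag_refl eqxx.
  move: pu; rewrite /pushes /rowp /posp => /and3P[/eqP r_eq /eqP c_eq /eqP xpu].
  rewrite xpu xu eqxx; split => //; apply: diag_trans d.
  by rewrite /diag; move: r_eq c_eq; rewrite -!/(prow _) -!/(ppos _); lia.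
move: p'; apply: (@diag_ind p (fun p' => x p == x p' -> connect (pushes x) p p')) => //.
move=> u v d IH r_eq c_eq /eqP xv.
have xu : x p = x u.
  apply/eqP; rewrite eq_le (diag_le ix d)/= xv.
  exact: interlacing_right ix r_eq c_eq.
apply: connect_trans (IH _) _; first exact/eqP.
apply: connect1; rewrite /pushes /rowp /posp -!/(prow _) -!/(ppos _) r_eq c_eq.
by rewrite -xu xv !eqxx.
Qed.

Definition seg p e u := diag p u && diag u e.

Definition chain_end x p := [arg max_(e > p | diag p e && (x p == x e)) prow e].

Definition chain_start y e := [arg min_(p < e | diag p e && (y p == y e)) prow p].

Lemma chain_endP x p : [/\ diag p (chain_end x p), x (chain_end x p) = x p &
  forall u, diag p u -> x u = x p -> diag u (chain_end x p)].
Proof.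
rewrite /chain_end; case: arg_maxnP => [|e /andP[d /eqP xe] H].
  by rewrite diag_refl eqxx.
split=> // u du xu; have := H u; rewrite du xu eqxx => /(_ isT).
by move: d du; rewrite /diag; lia.
Qed.

Lemma chain_startP y e : [/\ diag (chain_start y e) e, y (chain_start y e) = y e &
  forall u, diag u e -> y u = y e -> diag (chain_start y e) u].
Proof.
rewrite /chain_start; case: arg_minnP => [|p /andP[d /eqP xe] H].
  by rewrite diag_refl eqxx.
split=> // u du xu; have := H u; rewrite du xu eqxx => /(_ isT).
by move: d du; rewrite /diag; lia.
Qed.

Lemma chain_endE x p e : diag p e -> x e = x p ->
  (forall u, diag p u -> x u = x p -> diag u e) -> chain_end x p = e.
Proof.
move=> d xe H; have [d' xe' H'] := chain_endP x p.
have := H _ d' xe'; have := H' _ d xe => d1 d2.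
by apply: particle_inj; move: d1 d2; rewrite /diag; lia.
Qed.

Lemma chain_startE y e p : diag p e -> y p = y e ->
  (forall u, diag u e -> y u = y e -> diag p u) -> chain_start y e = p.
Proof.
move=> d xe H; have [d' xe' H'] := chain_startP y e.
have := H _ d' xe'; have := H' _ d xe => d1 d2.
by apply: particle_inj; move: d1 d2; rewrite /diag; lia.
Qed.

Lemma jumpE x p u : interlacing x ->
  jump x p u = x u + (seg p (chain_end x p) u)%:Z.
Proof.
move=> ix; rewrite ffunE connect_pushes//; congr (_ + (nat_of_bool _)%:Z).
have [d xe H] := chain_endP x p.
apply/andP/andP => -[du]; first by move=> /eqP xu; rewrite H.
move=> ue; split=> //; rewrite eq_le (diag_le ix du)/= -xe.
exact: diag_le.
Qed.

Lemma blockedP x p : reflect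
  (exists2 u, prow p = (prow u).+1 /\ ppos p = ppos u & x p = x u) (blocked x p).
Proof.
apply: (iffP existsP) => [[u /and3P[/eqP[h1] /eqP[h2] /eqP h3]]|[u [h1 h2] h3]].
  by exists u.
by exists u; rewrite /rowp /posp -!/(prow _) -!/(ppos _) h1 h2 h3 !eqxx.
Qed.

(** If [p] is not blocked, all entries after [p] on the next diagonal to the
    right exceed [x p], so the chain moved with [p] does not hit them. *)
Lemma jump_interlacing x p : interlacing x -> ~~ blocked x p ->
  interlacing (jump x p).
Proof.
move=> ix nb; have [d xe H] := chain_endP x p; set e := chain_end x p in d xe H *.
have seg_x u : seg p e u -> x u = x p.
  move=> /andP[pu ue]; apply/eqP; rewrite eq_le (diag_le ix pu) andbT -xe.
  exact: diag_le.
apply/interlacingP => u v r_uv; rewrite !jumpE// -/e; split=> c_uv.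
- have xvu := interlacing_left ix r_uv c_uv.
  have [sv|nsv] := boolP (seg p e v); last by rewrite addr0 (le_trans xvu)// lerDl.
  suff : x p < x u by move: (seg_x _ sv); lia.
  have hp := ppos_le p; have hu := ppos_le u; have hun := prow_lt u.
  have hv := prow_lt v.
  (* The only particle that could block [p]. It lies strictly to the right of [p], and its diagonal
     leads to [u]. *)
  have [||a [ar ac]] := @particle_exists (prow p).-1 (ppos p).
  + by have := prow_lt p; lia.
  + by move: sv; rewrite /seg /diag; lia.
  have rpa : prow p = (prow a).+1.
    by move: sv; rewrite /seg /diag; lia.
  have xpa : x p < x a.
    rewrite lt_neqAle (interlacing_left ix rpa)// andbT.
    by apply: contra nb => /eqP xpa; apply/blockedP; exists a.
  apply: lt_le_trans xpa _; apply: (diag_le ix).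
  by move: sv; rewrite /seg /diag; lia.
- have xuv := interlacing_right ix r_uv c_uv.
  have [su|nsu] := boolP (seg p e u); last by rewrite addr0 (le_trans xuv)// lerDl.
  have [sv|nsv] := boolP (seg p e v); first by rewrite lerD2r.
  have pv : diag p v by move: su; rewrite /seg /diag; lia.
  have xv : x v != x p.
    by apply: contra nsv => /eqP xv; rewrite /seg pv H.
  by move: (seg_x _ su) xuv xv; lia.
Qed.

(** For a chain [seg p e] of equal entries of [y], the pattern before the jump. *)
Definition lower y p e : triangle n := [ffun u => y u - (seg p e u)%:Z].

(** The particle under [e] in its column is not blocked by [e], so [e] can be lowered by one without
    violating that inequality. Vacuous in the bottom row. *)
Definition removable y e := [forall v,
  (prow v == (prow e).+1) && (ppos v == ppos e) ==> (y v != y e)].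

Lemma removableP y e : interlacing y -> reflect
  (forall v, prow v = (prow e).+1 -> ppos v = ppos e -> y v < y e) (removable y e).
Proof.
move=> iy; apply: (iffP forallP) => H v.
  move=> r_eq c_eq; have := H v; rewrite r_eq c_eq !eqxx/= => ne.
  by rewrite lt_neqAle ne (interlacing_left iy).
by apply/implyP => /andP[/eqP h1 /eqP h2]; rewrite lt_eqF// H.
Qed.

(** The end of the chain and [y] determine both [p] and [x]: above [p] on the diagonal, entries of
    [y] are unmoved and below the new common value. *)
Lemma jump_lower x y p : interlacing x -> jump x p = y ->
  let e := chain_end x p in
  [/\ removable y e, chain_start y e = p & x = lower y p e].
Proof.
move=> ix jxy e; have [d xe H] := chain_endP x p; rewrite -/e in d xe H.
have yE u : y u = x u + (seg p e u)%:Z by rewrite -jxy jumpE.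
have see : seg p e e by rewrite /seg d diag_refl.
have spp : seg p e p by rewrite /seg d diag_refl.
split.
- apply/forallP => v; apply/implyP => /andP[/eqP r_eq /eqP c_eq].
  have nsv : seg p e v = false.
    by apply/negP; rewrite /seg /diag; lia.
  have := interlacing_left ix r_eq c_eq.
  by rewrite !yE nsv see; lia.
- apply: chain_startE => //; first by rewrite !yE see spp xe.
  move=> u ue; rewrite !yE see xe.
  have [/andP[]//|nsu] := boolP (seg p e u).
  have : ~~ diag p u by move: nsu; rewrite /seg ue andbT.
  move=> npu; have up : diag u p by move: ue d npu; rewrite /diag; lia.
  by have := diag_le ix up; lia.
- by apply/ffunP => u; rewrite ffunE yE addrK.
Qed.

(** The converse: a removable [e] that exceeds its left neighbour in its row is the end of the chain
    of an actual jump into [y]. *)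
Lemma lower_jump y e : interlacing y -> removable y e ->
  (forall v, prow v = prow e -> (ppos v).+1 = ppos e -> y v < y e) ->
  let p := chain_start y e in let x := lower y p e in
  [/\ interlacing x, ~~ blocked x p, jump x p = y & chain_end x p = e].
Proof.
move=> iy /(removableP _ iy) rem row p x.
have [d yp H] := chain_startP y e; rewrite -/p in d yp H.
have xE u : x u = y u - (seg p e u)%:Z by rewrite ffunE.
have see : seg p e e by rewrite /seg d diag_refl.
have spp : seg p e p by rewrite /seg d diag_refl.
have seg_y u : seg p e u -> y u = y e.
  move=> /andP[pu ue]; apply/eqP; rewrite eq_le (diag_le iy ue)/= -yp.
  exact: diag_le.
(* Entries under the chain, other than the one under [e], lie on the next diagonal to the left,
   which increases towards the left neighbour of [e]. *)
have below u v : seg p e u -> prow v = (prow u).+1 -> ppos v = ppos u -> y v < y e.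
  move=> su r_eq c_eq; have [ue|ne] := eqVneq u e.
    by rewrite ue in r_eq c_eq; exact: rem.
  have hu := ppos_le u; have he := ppos_le e; have hen := prow_lt e.
  have lt : (prow u < prow e)%N.
    rewrite ltn_neqAle; apply/andP; split; last by move: su; rewrite /seg /diag; lia.
    apply: contra ne => /eqP re; apply/eqP/particle_inj => //.
    by move: su; rewrite /seg /diag; lia.
  have [||v' [r' c']] := @particle_exists (prow e) (ppos e).-1; [lia..|].
  apply: (@le_lt_trans _ _ (y v')).
    by apply: (diag_le iy); move: su; rewrite /seg /diag; lia.
  by apply: row => //; move: su; rewrite /seg /diag; lia.
have ix : interlacing x.
  apply/interlacingP => u v r_uv; rewrite !xE; split=> c_uv.
  - have := interlacing_left iy r_uv c_uv.
    have [su|_] := boolP (seg p e u); last by lia.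
    by have := below _ _ su r_uv c_uv; have := seg_y _ su; lia.
  - have := interlacing_right iy r_uv c_uv.
    have [sv|_] := boolP (seg p e v); last by lia.
    have [su|nsu] := boolP (seg p e u); first by lia.
    have ue : diag u e by move: sv; rewrite /seg /diag; lia.
    have : y u != y e by apply: contra nsu => /eqP yu; rewrite /seg H.
    by have := seg_y _ sv; lia.
have ce : chain_end x p = e.
  apply: chain_endE => //; first by rewrite !xE see spp yp.
  move=> u pu; rewrite !xE spp yp.
  have [/andP[]//|nsu] := boolP (seg p e u).
  have eu : diag e u by move: pu nsu d; rewrite /seg /diag; lia.
  by have := diag_le iy eu; lia.
split=> //.
- apply/negP => /blockedP[u [r_eq c_eq]]; rewrite !xE spp.
  have -> : seg p e u = false by apply/negP; rewrite /seg /diag; lia.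
  by have := interlacing_left iy r_eq c_eq; lia.
- by apply/ffunP => u; rewrite jumpE// ce ffunE subrK.
Qed.

End Particles.

(** * Weights *)

Section Fibres.
Variable n : nat.
Implicit Types (p e u v : particle n) (x y : triangle n).

Lemma prow_bottom (i : 'I_n) : prow (bottom_particle i) = n.-1.
Proof. by []. Qed.

Lemma ppos_bottom (i : 'I_n) : ppos (bottom_particle i) = i.
Proof. by []. Qed.

Lemma bottom_particleE u : prow u = n.-1 -> u = bottom_particle (val u).2.
Proof. by move=> r_eq; apply: particle_inj. Qed.

Lemma column_le x u v : interlacing x -> ppos u = ppos v ->
  (prow u <= prow v)%N -> x v <= x u.
Proof.
move=> ix; move: {2}(prow v) (leqnn (prow v)) => k.
elim: k v => [|k IH] v vk c_eq r_le.
  by rewrite (@particle_inj _ u v)//; lia.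
have [r_eq|r_ne] := eqVneq (prow u) (prow v); first by rewrite (@particle_inj _ u v).
have hv := prow_lt v; have hu := ppos_le u.
have [||w [rw cw]] := @particle_exists n (prow v).-1 (ppos v); [lia..|].
apply: (@le_trans _ _ (x w)); last by apply: IH; lia.
by apply: interlacing_left => //; lia.
Qed.

(** Following the column of [u] down to the bottom row gives the lower bound, following its diagonal
    the upper one. *)
Lemma entry_bounds x u : interlacing x ->
  exists i j : 'I_n, x (bottom_particle i) <= x u <= x (bottom_particle j).
Proof.
move=> ix; have hu := prow_lt u; have hc := ppos_le u.
have [||v [rv cv]] := @particle_exists n n.-1 (ppos u); [lia..|].
have [||w [rw cw]] := @particle_exists n n.-1 (ppos u + (n.-1 - prow u)); [lia..|].
exists (val v).2, (val w).2; rewrite -!bottom_particleE//; apply/andP; split.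
  by apply: column_le; lia.
by apply: diag_le => //; rewrite /diag; lia.
Qed.

Lemma finite_patterns (z : {ffun 'I_n -> int}) :
  finite_set [set x : pattern n | val (bottom_row x) = z].
Proof.
have [->|/set0P[x0 _]] := eqVneq [set x : pattern n | val (bottom_row x) = z] set0.
  exact: finite_set0.
pose B := (\sum_(i < n) `|z i|)%N.
have leB i : (`|z i| <= B)%N by rewrite /B (bigD1 i)//= leq_addr.
(* All entries lie in [[-B, B]], so shifting by [B] encodes a pattern by a finite function; codes of
   no pattern go to [x0]. *)
pose f (g : {ffun particle n -> 'I_(B + B).+1}) : pattern n :=
  insubd x0 [ffun u => (g u)%:Z - B%:Z].
apply: (@sub_finite_set _ _ (f @` [set: {ffun particle n -> 'I_(B + B).+1}])).
  move=> x /= xz; exists [ffun u => inord (absz (val x u + B%:Z))] => //.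
  rewrite /f; apply: val_inj; rewrite val_insubd.
  have -> : [ffun u => ([ffun u => inord (absz (val x u + B%:Z))] u : 'I_(B + B).+1)%:Z - B%:Z]
      = val x :> triangle n.
    apply/ffunP => u; rewrite !ffunE.
    have [i [j /andP[]]] := entry_bounds u (valP x).
    have zE k : val x (bottom_particle k) = z k by rewrite -xz ffunE.
    rewrite !zE => h1 h2; have := leB i; have := leB j => bi bj.
    move: h1 h2 bi bj; move: (z i) (z j) (val x u) => a b c h1 h2 bi bj.
    by clear -h1 h2 bi bj; rewrite inordK; lia.
  by rewrite (valP x).
exact/finite_image/finite_finset.
Qed.

Definition fibre (z : weyl n) : seq (pattern n) :=
  finmap.enum_fset (fset_set [set x : pattern n | val (bottom_row x) = val z]).

Lemma fibre_uniq z : uniq (fibre z). Proof. exact: finmap.fset_uniq. Qed.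

Lemma mem_fibre z (x : pattern n) : (x \in fibre z) = (bottom_row x == z).
Proof.
transitivity (x \in [set x : pattern n | val (bottom_row x) = val z]).
  exact: (in_fset_set (finite_patterns (val z)) x).
apply/idP/eqP => [|<-]; last by rewrite inE.
by rewrite inE => H; exact: val_inj.
Qed.

Lemma fibre_nonempty z : exists x : pattern n, x \in fibre z.
Proof.
(* The pattern whose columns are constant. *)
pose t : triangle n := [ffun u => val z (val u).2].
have it : interlacing t.
  apply/interlacingP => u v r_uv; rewrite !ffunE; split=> c_uv.
    by rewrite (_ : (val v).2 = (val u).2)//; exact: val_inj.
  have /forallP/(_ (val u).2)/forallP/(_ (val v).2) := valP z.
  by move=> /implyP; apply; rewrite -/(ppos _) -/(ppos _) c_uv.
exists (exist _ t it); rewrite mem_fibre; apply/eqP/val_inj/ffunP => i.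
by rewrite !ffunE.
Qed.

End Fibres.

Section Weights.
Variables (R : realType) (n : nat) (q : 'I_n -> R).
Hypothesis q_gt0 : forall k, 0 < q k.

Lemma weight_gt0 x : 0 < weight q x.
Proof. by apply: prodr_gt0 => i _; exact: exprz_gt0. Qed.

Lemma schurE (z : weyl n) : schur q (val z) = \sum_(x <- fibre z) weight q x.
Proof. by rewrite /schur fsbig_finite//; exact: finite_patterns. Qed.

Lemma schur_gt0 (z : weyl n) : 0 < schur q (val z).
Proof.
have [x xz] := fibre_nonempty z; rewrite schurE (bigD1_seq x)//=; last exact: fibre_uniq.
by rewrite ltr_wpDr ?weight_gt0// sumr_ge0// => y _; exact/ltW/weight_gt0.
Qed.

(** The rate [q] of the row below that of [e]; 1 if there is none. *)
Definition row_rate (e : particle n) : R :=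
  \prod_(i < n) q i ^+ (i == (prow e).+1 :> nat).

Lemma row_rate_bottom e : prow e = n.-1 -> row_rate e = 1.
Proof.
move=> re; rewrite /row_rate big1// => i _; rewrite re; have := ltn_ord i.
by case: eqP; rewrite ?expr0//; lia.
Qed.

Lemma row_rateE e (i : 'I_n) : i = (prow e).+1 :> nat -> row_rate e = q i.
Proof.
move=> ie; rewrite /row_rate (bigD1 i)//= ie eqxx expr1 big1 ?mulr1// => j ji.
by rewrite -ie val_eqE (negPf ji).
Qed.

(** The segment meets each row between those of [p] and [e] exactly once. Here [k] counts rows from
    1 and [prow] from 0. *)
Lemma rowsum_seg (x y : triangle n) p e k : diag p e ->
  (forall u, y u = x u + (seg p e u)%:Z) ->
  rowsum y k = rowsum x k + (prow p < k <= (prow e).+1)%N%:Z.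
Proof.
move=> d yE; rewrite /rowsum (eq_bigr _ (fun u _ => yE u)) big_split/=.
congr (_ + _); have he := prow_lt e; have hp := ppos_le p; have hpe := ppos_le e.
have [/andP[pk ke]|nk] := boolP (prow p < k <= (prow e).+1)%N.
  have [||a [ra ca]] := @particle_exists n k.-1 (ppos p + (k.-1 - prow p)); [lia..|].
  rewrite (bigD1 a)/=; last by rewrite /rowp -/(prow a); lia.
  have -> : seg p e a by move: d; rewrite /seg /diag; lia.
  rewrite big1 ?addr0// => u /andP[/eqP ru]; move: ru; rewrite /rowp -/(prow u) => ru ua.
  have [su|//] := boolP (seg p e u).
  by case/eqP: ua; apply: particle_inj; move: su; rewrite /seg /diag; lia.
rewrite big1// => u /eqP; rewrite /rowp -/(prow u) => ru.
have [su|//] := boolP (seg p e u).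
by case/negP: nk; move: su; rewrite /seg /diag; lia.
Qed.

(** Successive row sums are subtracted in the exponents, so only the row of [p] gains a factor and
    only the row below [e], if any, loses one. *)
Lemma weight_seg (x y : pattern n) p e : diag p e ->
  (forall u, val y u = val x u + (seg p e u)%:Z) ->
  weight q y * row_rate e = weight q x * q (val p).1.
Proof.
move=> d yE.
have qp : q (val p).1 = \prod_(i < n) q i ^ (i == prow p :> nat)%:Z.
  rewrite (bigD1 (val p).1)//= eqxx expr1z big1 ?mulr1// => i ip.
  by rewrite /prow val_eqE (negPf ip).
rewrite qp /weight /row_rate -!big_split/=; apply: eq_bigr => i _.
have qi : q i != 0 by rewrite gt_eqF.
rewrite exprnP -!expfzDr//; congr (_ ^ _).
rewrite !(@rowsum_seg (sval x) (sval y) _ _ _ d yE); have hi := ltn_ord i.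
by move: d; rewrite /diag; lia.
Qed.

End Weights.

(** * Intertwining *)

Section Incoming.
Variables (R : realType) (n : nat) (q : 'I_n -> R).
Hypothesis q_gt0 : forall k, 0 < q k.
Implicit Types (x y : pattern n) (z : weyl n) (p e u v : particle n).

Let jumps_to x p y := ~~ blocked (val x) p && (jump (val x) p == val y).

(** [y] has bottom row [z] up to the move of [e], if [e] is in that row. *)
Definition moves_bottom z y e := [forall i : 'I_n,
  val z i + (bottom_particle i == e)%:Z == val y (bottom_particle i)].

Lemma jump_seg x y p : jump (val x) p = val y ->
  forall u, val y u = val x u + (seg p (chain_end (val x) p) u)%:Z.
Proof. by move=> <- u; rewrite jumpE//; exact: (valP x). Qed.

Lemma bottom_particle_eq (i j : 'I_n) :
  (bottom_particle i == bottom_particle j) = (i == j).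
Proof. by apply/eqP/eqP => [/(congr1 (fun u => (val u).2))|->]. Qed.

Lemma seg_bottom p e (i : 'I_n) : diag p e ->
  seg p e (bottom_particle i) = (bottom_particle i == e).
Proof.
move=> d; apply/idP/eqP => [s|->]; last by rewrite /seg d diag_refl.
have he := prow_lt e; have rb := prow_bottom i; have cb := ppos_bottom i.
by apply: particle_inj; move: s; rewrite /seg /diag; lia.
Qed.

Lemma jump_removable z x y p : x \in fibre z -> jump (val x) p = val y ->
  removable (val y) (chain_end (val x) p) && moves_bottom z y (chain_end (val x) p).
Proof.
rewrite mem_fibre => /eqP <- jxy; have [-> _ _] := jump_lower (valP x) jxy.
have [d _ _] := chain_endP (val x) p.
by apply/forallP => i; rewrite (jump_seg jxy) ffunE seg_bottom.
Qed.

Lemma removable_jump z y e : removable (val y) e -> moves_bottom z y e ->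
  exists x, [/\ x \in fibre z, jumps_to x (chain_start (val y) e) y &
    chain_end (val x) (chain_start (val y) e) = e].
Proof.
move=> rem /forallP mov; have iy := valP y.
have [d _ _] := chain_startP (val y) e.
have he := prow_lt e.
case: (@lower_jump n (val y) e iy rem) => [v r_eq c_eq|ix nb jE ce].
  (* The left neighbour [v] of [e] is smaller: in an inner row the entry [w] under [e] separates
     them; in the bottom row, [z] is weakly increasing and only [e] has moved. *)
  have [en|en] := eqVneq (prow e) n.-1; last first.
    have [||w [rw cw]] := @particle_exists n (prow e).+1 (ppos e).
    - lia.
    - by have := ppos_le e; lia.
    have yw := (removableP e iy rem) w rw cw.
    by apply: le_lt_trans yw; apply: interlacing_right => //; lia.
  have vb := bottom_particleE (etrans r_eq en); have eb := bottom_particleE en.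
  set j := (val v).2 in vb; set i := (val e).2 in eb.
  have ij : i = j.+1 :> nat by rewrite /i /j -/(ppos v) -/(ppos e) c_eq.
  have := mov i; have := mov j; rewrite -vb -eb eqxx => /eqP <- /eqP <-.
  have -> : (v == e) = false by apply/eqP => ve; move: c_eq; rewrite ve; lia.
  have /forallP/(_ j)/forallP/(_ i)/implyP := valP z; rewrite ij eqxx => /(_ isT).
  by move=> zji; rewrite addr0 ltzD1.
exists (exist (fun x : triangle n => interlacing x) _ ix).
split=> //; last by rewrite /jumps_to nb/= jE.
rewrite mem_fibre; apply/eqP/val_inj/ffunP => i; rewrite !ffunE seg_bottom//.
by rewrite -(eqP (mov i)) addrK.
Qed.

(** Jumps into [y] from the fibre of [z] correspond to the admissible chain ends [e]; [weight_seg]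
    rewrites the contribution of each in terms of [y]. *)
Lemma weight_GT_rate z y :
  \sum_(x <- fibre z) weight q x * GT_rate q x y =
  weight q y * \sum_(e | removable (val y) e && moves_bottom z y e) row_rate q e.
Proof.
pose F x p e := if e == chain_end (val x) p then weight q y * row_rate q e else 0.
transitivity (\sum_(x <- fibre z) \sum_(p | jumps_to x p y) \sum_e F x p e).
  apply: eq_bigr => x _; rewrite /GT_rate mulr_sumr; apply: eq_bigr => p /andP[_ /eqP jxy].
  rewrite /F -big_mkcond big_pred1_eq.
  have [d _ _] := chain_endP (val x) p.
  by rewrite (weight_seg q_gt0 d (jump_seg jxy)).
under eq_bigr do rewrite exchange_big/=.
rewrite exchange_big/= mulr_sumr [RHS]big_mkcond/=; apply: eq_bigr => e _.
case: ifPn => [/andP[rem mov]|nrem]; last first.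
  rewrite big_seq big1// => x xz; rewrite big1// => p /andP[_ /eqP jxy].
  rewrite /F; case: eqP => // ee; case/negP: nrem.
  by rewrite ee; exact: jump_removable.
have [x0 [x0z jx0 ce]] := removable_jump rem mov; set p0 := chain_start _ _ in jx0 ce.
rewrite (bigD1_seq x0)//=; last exact: fibre_uniq.
rewrite (bigD1 p0)//= {1}/F ce eqxx !big1 ?addr0//.
- move=> x xx0; rewrite big1// => p /andP[_ /eqP jxy]; rewrite /F.
  case: eqP => // ee; case/eqP: xx0; apply: val_inj.
  have [_ p0E ->] := jump_lower (valP x) jxy.
  have /andP[_ /eqP jx0y] := jx0.
  have [_ _ ->] := jump_lower (valP x0) jx0y.
  by rewrite ce -/p0; rewrite -ee in p0E *; rewrite -p0E.
- move=> p /andP[/andP[_ /eqP jxy] pp0]; rewrite /F; case: eqP => // ee.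
  by case/eqP: pp0; have [_ <- _] := jump_lower (valP x0) jxy; rewrite -ee.
Qed.

(** The bottom row changes only if the chain ends in it, where every particle is removable and
    [row_rate] is 1. *)
Lemma sum_removable_bottom z y : bottom_row y != z ->
  \sum_(e | removable (val y) e && moves_bottom z y e) row_rate q e =
  \sum_(i < n | val (bottom_row y) == val z + basis_vector i) 1.
Proof.
move=> yz.
have mov e : moves_bottom z y e -> prow e == n.-1.
  move=> /forallP mov; apply: contraNT yz => en; apply/eqP/val_inj/ffunP => i.
  rewrite !ffunE -(eqP (mov i)); case: eqP => [eb|]; last by rewrite addr0.
  by rewrite -eb prow_bottom eqxx in en.
transitivity (\sum_(e | (prow e == n.-1) && (removable (val y) e && moves_bottom z y e)) (1 : R)).
  apply: eq_big => e; first by have := mov e; case: moves_bottom; rewrite ?andbT ?andbF// => ->.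
  by move=> /andP[_ /mov/eqP]; exact: row_rate_bottom.
rewrite big_mkcondr/= (reindex_onto (@bottom_particle n) (fun e => (val e).2))/=; last first.
  by move=> e /eqP/bottom_particleE.
rewrite -big_mkcondr/=; apply: eq_bigl => i; rewrite eqxx /= andbT prow_bottom eqxx/=.
have -> : removable (val y) (bottom_particle i).
  apply/forallP => v; apply/implyP => /andP[/eqP rv _].
  by have := prow_lt v; rewrite rv prow_bottom; have := ltn_ord i; lia.
rewrite /=; apply/forallP/eqP => [H|H j].
  apply/ffunP => j; rewrite !ffunE -(eqP (H j)); congr (_ + (nat_of_bool _)%:Z).
  by rewrite bottom_particle_eq.
have := congr1 (fun f : {ffun 'I_n -> int} => f j) H; rewrite !ffunE => ->.
apply/eqP; congr (_ + (nat_of_bool _)%:Z).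
by rewrite bottom_particle_eq.
Qed.

Definition total_rate x := \sum_(p | ~~ blocked (val x) p) q (val p).1.

(** The last particles of the rows are never blocked and give the sum of all [q k]. Any other one is
    unblocked iff the particle above it in its column is removable. *)
Lemma sum_removable_inner y :
  total_rate y = \sum_(k < n) q k +
  \sum_(e | removable (val y) e && moves_bottom (bottom_row y) y e) row_rate q e.
Proof.
have hn (e : particle n) : (prow e < n)%N by exact: prow_lt.
rewrite /total_rate (bigID (fun p => ppos p == prow p))/=; congr (_ + _).
  have diag_sub (k : 'I_n) : (k <= k)%N by [].
  rewrite (reindex_onto (fun k : 'I_n => exist _ (k, k) (diag_sub k) : particle n)
    (fun p => (val p).1))/=.
    apply: eq_bigl => k; rewrite !eqxx !andbT; apply/blockedP => -[u []].
    by have := ppos_le u; rewrite /prow /ppos /= => h1 h2 h3; lia.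
  move=> p /andP[_ /eqP pp]; apply: particle_inj => //.
(* Column neighbours; where there is none, the default is the particle itself. *)
pose below e : particle n := odflt e [pick v | (prow v == (prow e).+1) && (ppos v == ppos e)].
pose above p : particle n := odflt p [pick u | (prow p == (prow u).+1) && (ppos u == ppos p)].
have belowP e : ((prow e).+1 < n)%N -> prow (below e) = (prow e).+1 /\ ppos (below e) = ppos e.
  move=> en; rewrite /below; case: pickP => [v /andP[/eqP ? /eqP ?] //|no].
  have [|v [rv cv]] := @particle_exists n (prow e).+1 (ppos e) en.
    by have := ppos_le e; lia.
  by have := no v; rewrite rv cv !eqxx.
have aboveP p : (ppos p < prow p)%N -> prow p = (prow (above p)).+1 /\ ppos (above p) = ppos p.
  move=> pp; rewrite /above; case: pickP => [v /andP[/eqP ? /eqP ?] //|no].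
  have [||v [rv cv]] := @particle_exists n (prow p).-1 (ppos p).
  - by have := hn p; lia.
  - lia.
  by have := no v; rewrite rv cv eqxx andbT; lia.
rewrite (reindex_onto below above)/=; last first.
  move=> p /andP[_ pp]; have [|r1 c1] := aboveP p; first by have := ppos_le p; lia.
  have [|r2 c2] := belowP (above p); first by rewrite -r1.
  by apply: particle_inj; lia.
have movE e : moves_bottom (bottom_row y) y e = (prow e != n.-1).
  apply/forallP/idP => [H|en i].
    apply/eqP => /bottom_particleE eb; have := H (val e).2.
    by rewrite ffunE -eb eqxx; lia.
  rewrite ffunE; case: (_ =P e) => [eb|]; last by rewrite addr0.
  by rewrite -eb prow_bottom eqxx in en.
apply: eq_big => e.
  rewrite movE; have he := hn e; have [en|en] := eqVneq (prow e) n.-1.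
    rewrite andbF; apply/negbTE/negP => /andP[/andP[_ pp] /eqP ae].
    have be : below e = e.
      rewrite /below; case: pickP => // v /andP[/eqP rv _].
      by have := hn v; lia.
    rewrite be in pp ae; have [|r1 _] := aboveP e; first by have := ppos_le e; lia.
    by rewrite ae in r1; lia.
  have [|rb cb] := belowP e; first lia.
  have hc := ppos_le e.
  have [|ra ca] := aboveP (below e); first lia.
  have -> : above (below e) = e by apply: particle_inj; lia.
  rewrite eqxx !andbT; have -> : (ppos (below e) != prow (below e)) by lia.
  rewrite andbT; apply/idP/idP => [nb|/(removableP e (valP y)) rem].
    apply/forallP => v; apply/implyP => /andP[/eqP rv /eqP cv].
    have -> : v = below e by apply: particle_inj; lia.
    by apply: contra nb => /eqP ybe; apply/blockedP; exists e.
  apply/blockedP => -[u [ru cu] yu].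
  have ue : u = e by apply: particle_inj; lia.
  by have := rem _ rb cb; rewrite yu ue ltxx.
move=> /andP[/andP[_ pp] /eqP ae].
have [|r1 _] := aboveP (below e); first by have := ppos_le (below e); lia.
by apply/esym/row_rateE; rewrite -/(prow _) r1 ae.
Qed.



(** Contains [x] and all its successors; a jump that yields no pattern is replaced by [x]. *)
Definition targets x : seq (pattern n) :=
  undup (x :: [seq insubd x (jump (val x) p) | p <- enum {: particle n}]).

Lemma mem_targets x : x \in targets x.
Proof. by rewrite mem_undup mem_head. Qed.

Lemma jump_target x p : insubd x (jump (val x) p) \in targets x.
Proof.
rewrite mem_undup inE; apply/orP; right; apply/mapP.
by exists p; rewrite ?mem_enum.
Qed.

Lemma val_jump_target x p : ~~ blocked (val x) p ->
  val (insubd x (jump (val x) p)) = jump (val x) p.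
Proof.
by move=> nb; rewrite val_insubd jump_interlacing//; exact: (valP x).
Qed.

Lemma jump_neq x p : jump (val x) p != val x.
Proof.
apply/eqP => /(congr1 (fun f : triangle n => f p)).
by rewrite ffunE connect0; lia.
Qed.

Lemma GT_rate_ge0 x y : 0 <= GT_rate q x y.
Proof. by apply: sumr_ge0 => p _; exact: ltW. Qed.

Lemma GT_rate_self x : GT_rate q x x = 0.
Proof.
by rewrite /GT_rate big1// => p /andP[_]; rewrite (negPf (jump_neq x p)).
Qed.

Lemma GT_rate_out x y : y \notin targets x -> GT_rate q x y = 0.
Proof.
move=> yx; rewrite /GT_rate big1// => p /andP[nb /eqP jxy]; case/negP: yx.
have <- : insubd x (jump (val x) p) = y by apply: val_inj; rewrite val_jump_target.
exact: jump_target.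
Qed.

Lemma GT_total_rate x :
  \sum_(u <- targets x | u != x) GT_rate q x u = total_rate x.
Proof.
rewrite (exchange_big_dep (fun p => ~~ blocked (val x) p))/=; last by move=> u p _ /andP[].
apply: eq_bigr => p nb; pose u0 := insubd x (jump (val x) p).
rewrite (eq_bigl (pred1 u0)).
  rewrite big_mkcond (bigD1_seq u0)/= ?jump_target ?undup_uniq// eqxx.
  by rewrite big1 ?addr0// => u /negPf->.
move=> u /=; rewrite nb/=; apply/andP/eqP => [[_ /eqP jxu]|->].
  by apply: val_inj; rewrite /u0 val_jump_target.
rewrite val_jump_target//; split=> //.
by apply: contra (jump_neq x p) => /eqP u0x; rewrite -[X in _ == val X]u0x val_jump_target.
Qed.

Lemma total_rate_le x : total_rate x <= \sum_(p : particle n) q (val p).1.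
Proof.
rewrite /total_rate [leRHS](bigID (fun p => blocked (val x) p))/= lerDr.
by apply: sumr_ge0 => p _; exact: ltW.
Qed.

Lemma GT_Qmatrix_out x y : y \notin targets x -> GT_Qmatrix q x y = 0.
Proof.
move=> yx; rewrite /GT_Qmatrix /conservative; case: eqP => [xy|_].
  by rewrite -xy mem_targets in yx.
exact: GT_rate_out.
Qed.

Lemma GT_Qmatrix_diag x : GT_Qmatrix q x x = - total_rate x.
Proof.
rewrite -GT_total_rate; apply: conservative_diag; first exact: undup_uniq.
by move=> u ux _; exact: GT_rate_out.
Qed.

Lemma GT_Qmatrix_sum0 x : \sum_(u <- targets x) GT_Qmatrix q x u = 0.
Proof.
apply: conservative_sum0; [exact: undup_uniq| |exact: mem_targets].
by move=> u ux _; exact: GT_rate_out.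
Qed.

Lemma GT_Qmatrix_bound x : \sum_(u <- targets x) `|GT_Qmatrix q x u| <=
  2 * \sum_(p : particle n) q (val p).1.
Proof.
rewrite conservative_norm_sum ?undup_uniq ?mem_targets//.
- by rewrite GT_total_rate ler_pM2l// total_rate_le.
- by move=> u ux _; exact: GT_rate_out.
- exact: GT_rate_ge0.
Qed.

(** The mass [M_z(y)] at the bottom row [z] of [y]. *)
Definition schur_link y : R := weight q y / schur q (val (bottom_row y)).

Lemma schur_link_ge0 y : 0 <= schur_link y.
Proof. by rewrite divr_ge0// ltW// ?weight_gt0// schur_gt0. Qed.

Lemma schur_linkE z y : y \in fibre z -> schur_link y = weight q y / schur q (val z).
Proof. by rewrite mem_fibre /schur_link => /eqP->. Qed.

Lemma schur_link_sum1 z : \sum_(y <- fibre z) schur_link y = 1.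
Proof.
rewrite (eq_big_seq _ (schur_linkE (z := z))) -mulr_suml -schurE divff//.
by rewrite gt_eqF// schur_gt0.
Qed.

Lemma schur_link_GT_off z y : bottom_row y != z ->
  \sum_(x <- fibre z) schur_link x * GT_Qmatrix q x y =
  schur_rate q z (bottom_row y) * schur_link y.
Proof.
move=> yz; have Sz := schur_gt0 q_gt0 z; have Sy := schur_gt0 q_gt0 (bottom_row y).
transitivity ((\sum_(x <- fibre z) weight q x * GT_rate q x y) / schur q (val z)).
  rewrite mulr_suml; apply: eq_big_seq => x xz; rewrite (schur_linkE xz).
  rewrite /GT_Qmatrix /conservative; case: eqP => [xy|_]; last by rewrite mulrAC.
  by move: xz; rewrite mem_fibre xy (negPf yz).
rewrite weight_GT_rate sum_removable_bottom// /schur_rate mulr_sumr !mulr_suml.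
apply: eq_bigr => i /eqP <-; rewrite /schur_link mulr1 [RHS]mulrC mulrA divfK//.
by rewrite gt_eqF.
Qed.

(** The inflow within the fibre is the weight of [y] times its total rate minus the sum of all
    [q k]; the outflow cancels the total rate. *)
Lemma schur_link_GT_diag y :
  \sum_(x <- fibre (bottom_row y)) schur_link x * GT_Qmatrix q x y =
  - (\sum_(k < n) q k) * schur_link y.
Proof.
have yz : y \in fibre (bottom_row y) by rewrite mem_fibre.
have H := weight_GT_rate (bottom_row y) y; set s := \sum_(e | _) _ in H.
have tE := sum_removable_inner y; rewrite -/s in tE.
transitivity ((\sum_(x <- fibre (bottom_row y)) weight q x * GT_rate q x y -
    weight q y * total_rate y) / schur q (val (bottom_row y))).
  rewrite mulrBl mulr_suml (bigD1_seq y)//=; last exact: fibre_uniq.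
  rewrite [in RHS](bigD1_seq y)//=; last exact: fibre_uniq.
  rewrite GT_rate_self GT_Qmatrix_diag mulr0 mul0r add0r addrC; congr (_ + _); last first.
    by rewrite (schur_linkE yz); ring.
  rewrite big_seq_cond [RHS]big_seq_cond; apply: eq_bigr => x /andP[xz xy].
  by rewrite (schur_linkE xz) /GT_Qmatrix /conservative (negPf xy) mulrAC.
by rewrite H tE /schur_link; ring.
Qed.

Lemma schur_link_intertwining z y :
  \sum_(x <- fibre z) schur_link x * GT_Qmatrix q x y =
  schur_Qmatrix q z (bottom_row y) * schur_link y.
Proof.
exact: (conservative_intertwining (@fibre_uniq n) (@mem_fibre n) schur_link_sum1
  (fun x => undup_uniq _) mem_targets GT_Qmatrix_out GT_Qmatrix_sum0
  (kappa := fun=> \sum_(k < n) q k) schur_link_GT_off schur_link_GT_diag).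
Qed.

End Incoming.

Theorem theorem2p1 (R : realType) (n : nat) (hn : (1 <= n)%N)
    (q : 'I_n -> R) (hq : forall k, 0 < q k) (z : weyl n)
    (d : measure_display) (T : measurableType d) (P : probability T R)
    (X : R -> T -> pattern n) :
  markov_process P (schur_pmf q z) (GT_Qmatrix q) X ->
  markov_process P (fun x : weyl n => (x == z)%:R) (schur_Qmatrix q)
    (fun t w => bottom_row (X t w)).
Proof.
(* The initial law as a point mass on bottom rows times the link. *)
have -> : schur_pmf q z = fun x => (bottom_row x == z)%:R * schur_link q x.
  apply/funext => x; rewrite /schur_pmf /schur_link.
  by case: eqP => [->|_]; rewrite ?mul1r ?mul0r.
exact: (markov_process_link (@fibre_uniq n) (@mem_fibre n) (schur_link_ge0 hq)
  (schur_link_sum1 hq) (fun x => undup_uniq _) (@mem_targets n) (@GT_Qmatrix_out _ _ q)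
  (@GT_Qmatrix_sum0 _ _ q) (GT_Qmatrix_bound hq) (schur_link_intertwining hq)
  (nu := fun x => (x == z)%:R)).
Qed.
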